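(* Assume the Continuum Hypothesis. Let $K$ be a Valdivia compact space admitting a dense $\Sigma$-subset $A$ such that some point of $K\setminus A$ is the limit of a nontrivial convergent sequence in $K$. Then there exists a nontrivial twisted sum of $c_0$ and $C(K)$.
   Context: For a compact Hausdorff space $K$, $C(K)$ is the Banach space of continuous real-valued functions on $K$ with the supremum norm; $c_0$ is the Banach space of real sequences converging to zero. For Banach spaces $Y,X$, a twisted sum of $Y$ and $X$ is a short exact sequence $0\to Y\to Z\to X\to 0$ with $Z$ a Banach space and bounded linear maps; it is trivial if the image of $Y\to Z$ is complemented in $Z$. For an index set $I$, $\Sigma(I)=\{x\in\mathbb R^I:\{i: x_i\neq0\}\text{ is countable}\}$. A subset $A$ of a compact Hausdorff space $K$ is a $\Sigma$-subset if there exist an index set $I$ and a continuous injection $\varphi:K\to\mathbb R^I$ with $A=\varphi^{-1}[\Sigma(I)]$; $K$ is a Valdivia compactum if it admits a dense $\Sigma$-subset. A nontrivial sequence is one that is not eventually constant. *)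

(* Defs.v *)
From Stdlib Require Import Reals List.
Open Scope R_scope.

Definition CH : Prop :=
  forall S : R -> Prop,
    (exists f : nat -> R, forall x, S x -> exists n, f n = x) \/
    (exists g : R -> R, (forall y, S (g y)) /\ (forall y z, g y = g z -> y = z)).

Record Topology (X : Type) := {
  is_open : (X -> Prop) -> Prop;
  open_full : is_open (fun _ => True);
  open_inter : forall U V, is_open U -> is_open V -> is_open (fun x => U x /\ V x);
  open_union : forall F : (X -> Prop) -> Prop,
      (forall U, F U -> is_open U) -> is_open (fun x => exists U, F U /\ U x)
}.
Arguments is_open {X} t U.

Definition tcompact {X : Type} (t : Topology X) : Prop :=
  forall F : (X -> Prop) -> Prop,
    (forall U, F U -> is_open t U) -> (forall x, exists U, F U /\ U x) ->
    exists l : list (X -> Prop),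
      (forall U, In U l -> F U) /\ (forall x, exists U, In U l /\ U x).

Definition thausdorff {X : Type} (t : Topology X) : Prop :=
  forall x y : X, x <> y ->
    exists U V, is_open t U /\ is_open t V /\ U x /\ V y /\
                (forall z, ~ (U z /\ V z)).

Definition rcont {X : Type} (t : Topology X) (f : X -> R) : Prop :=
  forall x eps, 0 < eps ->
    exists U, is_open t U /\ U x /\ forall y, U y -> Rabs (f y - f x) < eps.

Definition tdense {X : Type} (t : Topology X) (A : X -> Prop) : Prop :=
  forall U, is_open t U -> (exists x, U x) -> exists x, U x /\ A x.

Definition tconverges {X : Type} (t : Topology X) (s : nat -> X) (x : X) : Prop :=
  forall U, is_open t U -> U x -> exists N, forall n, (N <= n)%nat -> U (s n).

Definition nontrivial_seq {X : Type} (s : nat -> X) : Prop :=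
  ~ exists N, forall n, (N <= n)%nat -> s n = s N.

Definition countable_set {I : Type} (P : I -> Prop) : Prop :=
  exists f : nat -> I, forall i, P i -> exists n, f n = i.

Definition Sigma_I (I : Type) (x : I -> R) : Prop :=
  countable_set (fun i => x i <> 0).

(* A is a Sigma-subset of K: there are an index set I and a continuous
   injection phi : K -> R^I (product topology, i.e. every coordinate
   continuous) with A = phi^{-1}[Sigma(I)]. *)
Definition Sigma_subset {K : Type} (t : Topology K) (A : K -> Prop) : Prop :=
  exists (I : Type) (phi : K -> I -> R),
    (forall i, rcont t (fun k => phi k i)) /\
    (forall k1 k2, phi k1 = phi k2 -> k1 = k2) /\
    (forall k, A k <-> Sigma_I I (phi k)).

Definition Valdivia {K : Type} (t : Topology K) : Prop :=
  exists A, Sigma_subset t A /\ tdense t A.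

Record Banach (Z : Type) := {
  bzero : Z;
  badd : Z -> Z -> Z;
  bopp : Z -> Z;
  bscal : R -> Z -> Z;
  bnorm : Z -> R;
  badd_assoc : forall x y z, badd x (badd y z) = badd (badd x y) z;
  badd_comm : forall x y, badd x y = badd y x;
  badd_zero : forall x, badd x bzero = x;
  badd_opp : forall x, badd x (bopp x) = bzero;
  bscal_one : forall x, bscal 1 x = x;
  bscal_assoc : forall a b x, bscal a (bscal b x) = bscal (a * b) x;
  bscal_distr_l : forall a x y, bscal a (badd x y) = badd (bscal a x) (bscal a y);
  bscal_distr_r : forall a b x, bscal (a + b) x = badd (bscal a x) (bscal b x);
  bnorm_nonneg : forall x, 0 <= bnorm x;
  bnorm_zero : forall x, bnorm x = 0 -> x = bzero;
  bnorm_scal : forall a x, bnorm (bscal a x) = Rabs a * bnorm x;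
  bnorm_triangle : forall x y, bnorm (badd x y) <= bnorm x + bnorm y;
  bcomplete : forall u : nat -> Z,
    (forall eps, 0 < eps -> exists N, forall m n, (N <= m)%nat -> (N <= n)%nat ->
        bnorm (badd (u m) (bopp (u n))) < eps) ->
    exists l, forall eps, 0 < eps -> exists N, forall n, (N <= n)%nat ->
        bnorm (badd (u n) (bopp l)) < eps
}.
Arguments bzero {Z} _.
Arguments badd {Z} _ _ _.
Arguments bopp {Z} _ _.
Arguments bscal {Z} _ _ _.
Arguments bnorm {Z} _ _.

Definition blinear {Z : Type} (B : Banach Z) (f : Z -> Z) : Prop :=
  forall a b x y, f (badd B (bscal B a x) (bscal B b y)) =
                  badd B (bscal B a (f x)) (bscal B b (f y)).

Definition c0 (y : nat -> R) : Prop := Un_cv y 0.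

(* C(K) = continuous real functions on K with the sup norm; a map
   q : Z -> C(K) is represented as q : Z -> K -> R with every q z continuous.
   j : c_0 -> Z is represented on sequences, only its values on c_0 matter.
   Bounded linear maps, exactness 0 -> c_0 -j-> Z -q-> C(K) -> 0. *)
Definition twisted_sum_c0_CK {K : Type} (t : Topology K)
    {Z : Type} (B : Banach Z) (j : (nat -> R) -> Z) (q : Z -> K -> R) : Prop :=
  (forall a b y1 y2, c0 y1 -> c0 y2 ->
     j (fun n => a * y1 n + b * y2 n) = badd B (bscal B a (j y1)) (bscal B b (j y2))) /\
  (exists M, forall y c, c0 y -> (forall n, Rabs (y n) <= c) -> bnorm B (j y) <= M * c) /\
  (forall z, rcont t (q z)) /\
  (forall a b z1 z2, q (badd B (bscal B a z1) (bscal B b z2)) =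
                     (fun k => a * q z1 k + b * q z2 k)) /\
  (exists M, forall z k, Rabs (q z k) <= M * bnorm B z) /\
  (forall y1 y2, c0 y1 -> c0 y2 -> j y1 = j y2 -> y1 = y2) /\
  (forall z, q z = (fun _ => 0) <-> exists y, c0 y /\ j y = z) /\
  (forall f, rcont t f -> exists z, q z = f).

Definition image_complemented {Z : Type} (B : Banach Z) (j : (nat -> R) -> Z) : Prop :=
  exists P : Z -> Z,
    blinear B P /\
    (exists M, forall z, bnorm B (P z) <= M * bnorm B z) /\
    (forall z, exists y, c0 y /\ P z = j y) /\
    (forall y, c0 y -> P (j y) = j y).

(* Main.v *)
(** Let [lt] well-order R with countable initial segments (this is where CH enters). Every
    point outside the Sigma-subset has uncountable support, so along this order one finds
    increasing countable coordinate sets J_i, J_i^+ such that truncating a given point y to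
    J_i, resp. J_i^+, yields points a_i, b_i of K that differ at some coordinate in
    J_i^+ \ J_i. A continuous f depends, up to eps, on finitely many coordinates, hence
    (f(b_i) - f(a_i))_i lies in c_0(R). Given an almost disjoint family (A_i) of sets of
    naturals, f |-> sum_i (f(b_i) - f(a_i)) 1_{A_i} is then a bounded operator from C(K) to
    l_infty/c_0, and the twisted sum is its pullback Z in C(K) + l_infty.

    The convergent sequence provides points y_n outside the Sigma-subset with disjointly
    supported bumps g_n, and each index i has a colour n and uses y = y_n. A function f_i
    supported in that of g_n detects the jump at i and no other. A projection P onto c_0 would
    turn (f_i, 1_{A_i}) into a sequence v_i eventually above 1/2 on A_i. The A_i are chains
    in the binary tree, built by diagonalization so that every set almost containing all the
    A_i of a given colour contains a cone below any prescribed node. Nesting cones for the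
    colours 0, ..., m-1 gives one p at which m of the v_i exceed 1/2, while the sum of the
    corresponding f_i has norm at most 1: for m large this contradicts boundedness of P. *)

Require Import Defs.
From mathcomp Require boolp wochoice.
From Stdlib Require Import Reals List Lra Lia Classical ClassicalEpsilon
  FunctionalExtensionality PropExtensionality ProofIrrelevance Cantor Wellfounded.
Set Bullet Behavior "Strict Subproofs".
Open Scope R_scope.

(** * Well-orders, codes and recursion *)

Lemma choice_ex {A B : Type} (Q : A -> B -> Prop) :
  (forall a, exists b, Q a b) -> exists f : A -> B, forall a, Q a (f a).
Proof.
  intros H.
  exists (fun a => proj1_sig (constructive_indefinite_description _ (H a))).
  intros a; exact (proj2_sig (constructive_indefinite_description _ (H a))).
Qed.

Lemma countable_union {I : Type} (P : nat -> I -> Prop) :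
  (forall n, countable_set (P n)) -> countable_set (fun i => exists n, P n i).
Proof.
  intros H; destruct (choice_ex _ H) as [F HF].
  exists (fun k => F (fst (of_nat k)) (snd (of_nat k))).
  intros i [n Hn]; destruct (HF n i Hn) as [m Hm].
  exists (to_nat (n, m)); rewrite cancel_of_to; exact Hm.
Qed.

Lemma countable_subset {I : Type} (P Q : I -> Prop) :
  (forall i, P i -> Q i) -> countable_set Q -> countable_set P.
Proof. intros PQ [f Hf]; exists f; intros i Pi; apply Hf, PQ, Pi. Qed.

Lemma countable_or {I : Type} (P Q : I -> Prop) :
  countable_set P -> countable_set Q -> countable_set (fun i => P i \/ Q i).
Proof.
  intros HP HQ.
  apply (countable_subset _ (fun i => exists n : nat, (match n with O => P | _ => Q end) i)).
  - intros i [h | h]; [exists 0%nat | exists 1%nat]; exact h.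
  - apply countable_union; intros [|n]; assumption.
Qed.

Lemma countable_range {I : Type} (e : nat -> I) : countable_set (fun i => exists n, e n = i).
Proof. exists e; auto. Qed.

(** * Sets of naturals coded as real numbers *)

Section Ternary.

Let digit (X : nat -> Prop) (n : nat) : R := if excluded_middle_informative (X n) then 1 else 0.

Let partial (X : nat -> Prop) : nat -> R :=
  fix S n := match n with O => 0 | Datatypes.S k => S k + digit X k * (/ 3) ^ k end.

(** [3 / 2 * (/ 3) ^ n] is the geometric tail from [n] on, so the intervals are nested; [r] is the
    supremum of their left ends. *)
Local Lemma ternary_sum (X : nat -> Prop) :
  exists r, forall n, partial X n <= r <= partial X n + 3 / 2 * (/ 3) ^ n.
Proof.
  assert (step : forall n, partial X n <= partial X (S n) /\
      partial X (S n) + 3 / 2 * (/ 3) ^ S n <= partial X n + 3 / 2 * (/ 3) ^ n).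
  { intros n.
    assert (h : 0 < (/ 3) ^ n) by (apply pow_lt; lra).
    cbn; unfold digit; destruct excluded_middle_informative; lra. }
  assert (mono : forall n k, partial X n <= partial X (n + k) /\
      partial X (n + k) + 3 / 2 * (/ 3) ^ (n + k) <= partial X n + 3 / 2 * (/ 3) ^ n).
  { intros n k; induction k as [|k IH].
    - rewrite Nat.add_0_r; lra.
    - rewrite Nat.add_succ_r; specialize (step (n + k)%nat); lra. }
  assert (up : forall m n, partial X m <= partial X n + 3 / 2 * (/ 3) ^ n).
  { intros m n.
    assert (h : 0 < (/ 3) ^ (m + n)) by (apply pow_lt; lra).
    destruct (mono m n) as [h1 _]; destruct (mono n m) as [_ h2].
    rewrite (Nat.add_comm n m) in h2; lra. }
  destruct (completeness (fun r => exists n, r = partial X n)) as [r [r_ub r_lub]].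
  - exists (partial X 0 + 3 / 2 * (/ 3) ^ 0); intros r [n ->]; apply up.
  - exists (partial X 0); exists 0%nat; reflexivity.
  - exists r; intros n; split.
    + apply r_ub; exists n; reflexivity.
    + apply r_lub; intros r' [m ->]; apply up.
Qed.

(** Base 3 with digits 0 and 1 makes expansions unique: at the first place [n] where two sets differ
    the sums part by [(/ 3) ^ n], and later digits make up at most half of that. *)
Lemma powerset_nat_embeds_R :
  exists F : (nat -> Prop) -> R, forall X Y, F X = F Y -> forall n, X n <-> Y n.
Proof.
  destruct (choice_ex _ ternary_sum) as [F HF].
  exists F; intros X Y e.
  enough (agree : forall n k, (k < n)%nat -> (X k <-> Y k)).
  { intros n; apply (agree (S n)); lia. }
  induction n as [|n IH]; [lia|].
  assert (same : partial X n = partial Y n).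
  { clear e; induction n as [|n IHn]; [reflexivity|].
    cbn; rewrite IHn by (intros k hk; apply IH; lia).
    assert (h := IH n (Nat.lt_succ_diag_r n)).
    unfold digit; destruct excluded_middle_informative, excluded_middle_informative; tauto. }
  intros k hk; destruct (Nat.eq_dec k n) as [-> | ne]; [|apply IH; lia].
  assert (h : 0 < (/ 3) ^ n) by (apply pow_lt; lra).
  assert (hX := HF X (S n)); assert (hY := HF Y (S n)); rewrite e in hX.
  cbn in hX, hY; unfold digit in hX, hY; rewrite same in hX.
  destruct (excluded_middle_informative (X n)), (excluded_middle_informative (Y n));
    try tauto; exfalso; lra.
Qed.

End Ternary.

(* Only the countability of initial segments is recorded; [W] need not be uncountable. *)
Record omega1_like {W : Type} (lt : W -> W -> Prop) : Prop := {
  ol_wf : well_founded lt;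
  ol_trans : forall i j k, lt i j -> lt j k -> lt i k;
  ol_total : forall i j, lt i j \/ i = j \/ lt j i;
  ol_seg : forall i, countable_set (fun j => lt j i)
}.

(** The principle invoked gives every nonempty set a unique least element. The laws of a linear
    order come from least elements of sets of one, two or three points; the strict part is
    well-founded because the inaccessible points would have a least one. *)
Lemma well_order_exists (T : Type) : exists lt : T -> T -> Prop,
  well_founded lt /\ (forall i j k, lt i j -> lt j k -> lt i k) /\
  (forall i j, lt i j \/ i = j \/ lt j i).
Proof.
  destruct (wochoice.well_ordering_principle
    (eqtype.Equality.Pack (eqtype.Equality.Class (boolp.gen_eqMixin T)))) as [le wo].
  assert (least_unique : forall P : T -> Prop, (exists x, P x) ->
            exists! x, P x /\ forall y, P y -> le x y = true).
  { intros P [x Px].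
    set (Q := fun y => if excluded_middle_informative (P y) then true else false).
    assert (QP : forall y, Q y = true <-> P y).
    { intros y; unfold Q; destruct excluded_middle_informative; split; try tauto; discriminate. }
    assert (h : exists! z, Q z = true /\ forall y, Q y = true -> le z y = true).
    { exact (wo Q (ex_intro (fun y => Q y = true) x (proj2 (QP x) Px))). }
    destruct h as [z [[Qz zmin] uniq]]; exists z; split.
    - split; [apply QP, Qz | intros y Py; apply zmin, QP, Py].
    - intros y [Py ymin]; apply uniq; split; [apply QP, Py | intros u Qu; apply ymin, QP, Qu]. }
  assert (least : forall P : T -> Prop, (exists x, P x) ->
            exists x, P x /\ forall y, P y -> le x y = true).
  { intros P h; destruct (least_unique P h) as [x [hx _]]; exists x; exact hx. }
  assert (refl : forall u, le u u = true).
  { intros u; destruct (least (fun v => v = u)) as [v [-> h]]; [exists u; reflexivity|].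
    apply h; reflexivity. }
  assert (anti : forall x y, le x y = true -> le y x = true -> x = y).
  { intros x y xy yx.
    destruct (least_unique (fun z => z = x \/ z = y)) as [z [_ uniq]]; [exists x; auto|].
    transitivity z; [symmetry|]; apply uniq; split; auto; intros v [-> | ->]; auto. }
  assert (total : forall x y, le x y = true \/ le y x = true).
  { intros x y; destruct (least (fun v => v = x \/ v = y)) as [v [[-> | ->] h]].
    - exists x; auto.
    - left; apply h; auto.
    - right; apply h; auto. }
  assert (trans : forall x y z, le x y = true -> le y z = true -> le x z = true).
  { intros x y z xy yz.
    destruct (least (fun v => v = x \/ v = y \/ v = z)) as [v [hv h]]; [exists x; auto|].
    destruct hv as [-> | [-> | ->]].
    - apply h; auto.
    - assert (e : x = y) by (apply anti; auto); rewrite e; exact yz.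
    - assert (e : y = z) by (apply anti; auto); rewrite <- e; exact xy. }
  exists (fun x y => le x y = true /\ x <> y); split; [|split].
  - intros x; apply NNPP; intros nacc.
    destruct (least (fun y => ~ Acc (fun x y => le x y = true /\ x <> y) y)) as [y [ny ymin]].
    { exists x; exact nacc. }
    apply ny; constructor; intros z [zy ne]; apply NNPP; intros nz.
    apply ne, anti; [exact zy | apply ymin, nz].
  - intros i j k [ij neij] [jk nejk]; split; [apply (trans _ j); assumption|].
    intros ->; apply neij, anti; assumption.
  - intros i j; destruct (classic (i = j)) as [e | ne]; [auto|].
    destruct (total i j); [left | right; right]; split; auto.
Qed.

(** If some initial segment is uncountable, let [a] be the least point with this property. CH
    injects R into the segment below [a] by some [g], and the order pulled back along [g] has
    countable segments since every [g i] lies below [a]. *)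
Lemma CH_omega1_like : CH -> exists lt : R -> R -> Prop, omega1_like lt.
Proof.
  intros ch; destruct (well_order_exists R) as [lt [wf [trans total]]].
  destruct (classic (forall i, countable_set (fun j => lt j i))) as [seg | nseg].
  { exists lt; constructor; assumption. }
  apply not_all_ex_not in nseg.
  assert (least : exists a, ~ countable_set (fun j => lt j a) /\
             forall b, lt b a -> countable_set (fun j => lt j b)).
  { apply NNPP; intros none; destruct nseg as [a na].
    induction (wf a) as [a _ IH]; apply none; exists a; split; [exact na|].
    intros b ba; apply NNPP; intros nb; exact (IH b ba nb). }
  destruct least as [a [na amin]].
  destruct (ch (fun j => lt j a)) as [cnt | [g [ga ginj]]]; [contradiction|].
  exists (fun x y => lt (g x) (g y)); constructor.
  - apply (wf_inverse_image R R lt g wf).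
  - intros i j k; apply trans.
  - intros i j; destruct (total (g i) (g j)) as [h | [h | h]]; auto.
  - intros i; destruct (amin (g i) (ga i)) as [f Hf].
    exists (fun n => epsilon (inhabits 0) (fun x => g x = f n)).
    intros j ji; destruct (Hf _ ji) as [n Hn]; exists n.
    apply ginj; rewrite Hn; apply epsilon_spec; exists j; reflexivity.
Qed.

(* The codes (n, s, B) list the tasks of the diagonalization: colour n, node s, target set B. *)
Lemma R_surjects_codes : exists code : R -> nat * nat * (nat -> Prop),
  forall c, exists r, code r = c.
Proof.
  destruct powerset_nat_embeds_R as [F HF].
  set (enc := fun (c : nat * nat * (nat -> Prop)) k =>
     let '(n, s, B) := c in
     match of_nat k with
     | (0, b) => b = n | (1, b) => b = s | (_, b) => B b end%nat).
  assert (inj : forall c d, F (enc c) = F (enc d) -> c = d).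
  { intros [[n s] B] [[n' s'] B'] e; assert (h := HF _ _ e); unfold enc in h.
    assert (n = n') as <-.
    { specialize (h (to_nat (0%nat, n))); rewrite cancel_of_to in h; apply h; reflexivity. }
    assert (s = s') as <-.
    { specialize (h (to_nat (1%nat, s))); rewrite cancel_of_to in h; apply h; reflexivity. }
    f_equal; apply functional_extensionality; intros b; apply propositional_extensionality.
    specialize (h (to_nat (2%nat, b))); rewrite cancel_of_to in h; exact h. }
  exists (fun r => epsilon (inhabits (0%nat, 0%nat, fun _ => False)) (fun c => F (enc c) = r)).
  intros c; exists (F (enc c)); apply inj; apply epsilon_spec; exists c; reflexivity.
Qed.

(** Transfinite recursion with a choice at each stage. [body] extends the values found so far by the
    default [x0]; since [P i] sees only values below [i], that extension can be replaced by [h]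
    itself. *)
Lemma wf_choice {W X : Type} (lt : W -> W -> Prop) (P : W -> (W -> X) -> X -> Prop) (x0 : X) :
  well_founded lt ->
  (forall i g g' x, (forall j, lt j i -> g j = g' j) -> P i g x -> P i g' x) ->
  (forall i g, (forall j, lt j i -> P j g (g j)) -> exists x, P i g x) ->
  exists h, forall i, P i h (h i).
Proof.
  intros wf ext step.
  set (body := fun i (rec : forall j, lt j i -> X) =>
    epsilon (inhabits x0) (P i (fun j =>
      match excluded_middle_informative (lt j i) with left l => rec j l | right _ => x0 end))).
  set (h := Fix wf (fun _ => X) body).
  assert (h_eq : forall i, h i = epsilon (inhabits x0) (P i (fun j =>
      if excluded_middle_informative (lt j i) then h j else x0))).
  { intros i; unfold h; rewrite Fix_eq; [reflexivity|].
    clear; intros i f g e; unfold body; f_equal; f_equal; apply functional_extensionality; intros j.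
    destruct excluded_middle_informative; auto. }
  assert (agree : forall i j, lt j i -> (if excluded_middle_informative (lt j i) then h j else x0) = h j).
  { intros i j ji; destruct excluded_middle_informative; [reflexivity | contradiction]. }
  exists h; intros i; induction (wf i) as [i _ IH].
  apply (ext i _ _ _ (agree i)); rewrite h_eq; apply epsilon_spec.
  destruct (step i h IH) as [x Hx]; exists x.
  apply (ext i h); [|exact Hx]; intros j ji; symmetry; auto.
Qed.

(** * The almost disjoint family of chains in the binary tree *)

(* The naturals are the nodes of the infinite binary tree, in heap numbering with root 0. *)
Definition child (s : nat) (d : bool) : nat := if d then 2 * s + 2 else 2 * s + 1.

(** [anc s] is the cone below [s], with [s] included. *)
Inductive anc (s : nat) : nat -> Prop :=
| anc_refl : anc s s
| anc_child p d : anc s p -> anc s (child p d).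

Lemma child_gt s d : (s < child s d)%nat.
Proof. unfold child; destruct d; lia. Qed.

Lemma child_inj s d t c : child s d = child t c -> s = t /\ d = c.
Proof.
  unfold child; destruct d, c; intros e; try (exfalso; lia); split; solve [lia | reflexivity].
Qed.

Lemma anc_le s p : anc s p -> (s <= p)%nat.
Proof. induction 1 as [|p d _ IH]; [|assert (h := child_gt p d)]; lia. Qed.

Lemma anc_trans s t p : anc s t -> anc t p -> anc s p.
Proof. intros st tp; induction tp; [exact st | constructor; assumption]. Qed.

Lemma anc_parent s q d : anc s (child q d) -> child q d = s \/ anc s q.
Proof.
  intros h; remember (child q d) as p eqn:Ep; destruct h as [|p' d' h]; [auto|].
  apply child_inj in Ep; destruct Ep as [-> _]; auto.
Qed.

Lemma anc_children_disjoint u p : anc (child u true) p -> anc (child u false) p -> False.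
Proof.
  assert (gt := child_gt u).
  induction 1 as [|q d h1 IH]; intros h2; destruct (anc_parent _ _ _ h2) as [e | h].
  - apply child_inj in e; destruct e; discriminate.
  - apply anc_le in h; specialize (gt false); lia.
  - apply child_inj in e; destruct e as [-> _].
    apply anc_le in h1; specialize (gt true); lia.
  - auto.
Qed.

Definition anc_chain (C : nat -> Prop) : Prop :=
  forall a b, C a -> C b -> anc a b \/ anc b a.

(** If the chain has a node [p] in one sibling cone, any node of it in the other would be comparable
    with [p], and one of the two would lie in both disjoint cones. *)
Lemma anc_chain_avoids (C : nat -> Prop) u :
  anc_chain C -> exists d, forall p, anc (child u d) p -> ~ C p.
Proof.
  intros chC.
  destruct (classic (exists p, anc (child u true) p /\ C p)) as [[p [up Cp]] | none].
  - exists false; intros q uq Cq; destruct (chC p q Cp Cq) as [h | h].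
    + apply (anc_children_disjoint u q); [apply (anc_trans _ p)|]; assumption.
    + apply (anc_children_disjoint u p); [|apply (anc_trans _ q)]; assumption.
  - exists true; intros p up Cp; apply none; exists p; auto.
Qed.

Definition finite_inter (C D : nat -> Prop) : Prop :=
  exists N, forall p, C p -> D p -> (p <= N)%nat.

(* A chain leaves [C k] for good by stepping into the one of two siblings that [C k] misses. *)
Lemma chain_avoiding (s : nat) (B : nat -> Prop) (C : nat -> nat -> Prop) :
  (forall t, anc s t -> exists p, anc t p /\ ~ B p) -> (forall k, anc_chain (C k)) ->
  exists A, anc_chain A /\ (forall k, finite_inter A (C k)) /\
            forall N, exists p, (N <= p)%nat /\ A p /\ ~ B p.
Proof.
  intros HB HC.
  (* [snd ku] is the current node and [fst ku] indexes the chain to leave; [v] is a node outside [B]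
     in the child cone that this chain misses. *)
  assert (step : forall ku : nat * nat, exists v, anc s (snd ku) ->
    anc (snd ku) v /\ (snd ku < v)%nat /\ ~ B v /\ forall p, anc v p -> ~ C (fst ku) p).
  { intros [k u]; cbn; destruct (classic (anc s u)) as [su | n]; [|exists 0%nat; tauto].
    destruct (anc_chain_avoids (C k) u (HC k)) as [d hd].
    assert (uc : anc u (child u d)) by (constructor; constructor).
    destruct (HB (child u d)) as [p [cp nBp]]; [apply (anc_trans _ u); assumption|].
    exists p; intros _; split; [apply (anc_trans _ (child u d)); assumption|].
    split; [assert (h := child_gt u d); apply anc_le in cp; lia|].
    split; [exact nBp|]; intros q pq; apply hd, (anc_trans _ p); assumption. }
  destruct (choice_ex _ step) as [f Hf].
  set (t := fix t k := match k with O => s | S k => f (k, t k) end).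
  assert (st : forall k, anc s (t k)).
  { induction k as [|k IH]; [constructor|].
    apply (anc_trans _ (t k)); [exact IH | apply (Hf (k, t k)), IH]. }
  assert (tt : forall k l, (k <= l)%nat -> anc (t k) (t l)).
  { induction 1 as [|l _ IH]; [constructor|].
    apply (anc_trans _ (t l)); [exact IH | apply (Hf (l, t l)), st]. }
  assert (tge : forall k, (k <= t k)%nat).
  { induction k as [|k IH]; [lia|].
    assert (h : (t k < t (S k))%nat) by apply (Hf (k, t k)), st; lia. }
  exists (fun p => exists k, p = t (S k)); split; [|split].
  - intros a b [k ->] [l ->]; destruct (Nat.le_ge_cases (S k) (S l)); [left | right]; auto.
  (* Nodes up to stage [k] are at most [t k]; the later ones lie below [t (S k)], whose cone misses
     [C k]. *)
  - intros k; exists (t k); intros p [l ->] Cp.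
    destruct (Nat.le_gt_cases (S l) k) as [h | h]; [apply anc_le, tt, h|].
    exfalso; apply (Hf (k, t k) (st k)) in Cp; [exact Cp|]; apply (tt (S k)); lia.
  - intros N; exists (t (S N)); split; [specialize (tge (S N)); lia|].
    split; [exists N; reflexivity | apply (Hf (N, t N)), st].
Qed.

(** Recursion along [lt]. When [B i] contains a cone below [s i], the empty set serves as [A i];
    otherwise [chain_avoiding] gives a chain leaving [B i] infinitely often and almost disjoint from
    the countably many earlier [A j]. *)
Lemma diagonal_family {W : Type} (lt : W -> W -> Prop) (s : W -> nat) (B : W -> nat -> Prop) :
  omega1_like lt ->
  exists A : W -> nat -> Prop,
    (forall i j, i <> j -> finite_inter (A i) (A j)) /\
    (forall i, (exists N, forall p, (N <= p)%nat -> A i p -> B i p) ->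
       exists t, anc (s i) t /\ forall p, anc t p -> B i p).
Proof.
  intros ol.
  destruct (wf_choice lt (fun i (g : W -> nat -> Prop) A =>
    anc_chain A /\ (forall j, lt j i -> finite_inter A (g j)) /\
    ((exists t, anc (s i) t /\ forall p, anc t p -> B i p) \/
     forall N, exists p, (N <= p)%nat /\ A p /\ ~ B i p)) (fun _ => False)) as [A HA].
  - apply (ol_wf lt ol).
  - intros i g g' X e [h1 [h2 h3]]; split; [exact h1 | split; [|exact h3]].
    intros j ji; rewrite <- e by exact ji; auto.
  - intros i g Hg.
    destruct (classic (exists t, anc (s i) t /\ forall p, anc t p -> B i p)) as [yes | no].
    { exists (fun _ => False); split; [intros a b []|]; split; [|left; exact yes].
      intros j _; exists 0%nat; intros p []. }
    destruct (ol_seg lt ol i) as [e He].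
    (* The enumeration [e] may leave the segment below [i]; the conjunct [lt (e k) i] turns such
       entries into the empty chain. *)
    destruct (chain_avoiding (s i) (B i) (fun k p => lt (e k) i /\ g (e k) p)) as [X [HX1 [HX2 HX3]]].
    + intros t st; apply NNPP; intros none; apply no; exists t; split; [exact st|].
      intros p tp; apply NNPP; intros nB; apply none; exists p; auto.
    + intros k a b [ki ga] [_ gb]; apply (Hg _ ki); assumption.
    + exists X; split; [exact HX1 | split; [|right; exact HX3]].
      intros j ji; destruct (He j ji) as [k <-]; destruct (HX2 k) as [N HN].
      exists N; intros p Xp gp; apply HN; auto.
  - exists A; split.
    + intros i j ne; destruct (ol_total lt ol i j) as [h | [h | h]]; [|contradiction|].
      * destruct (HA j) as [_ [h' _]]; destruct (h' i h) as [N HN]; exists N; auto.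
      * destruct (HA i) as [_ [h' _]]; exact (h' j h).
    + intros i [N HN]; destruct (HA i) as [_ [_ [h | h]]]; [exact h|].
      destruct (h N) as [p [Np [Ap nB]]]; destruct nB; auto.
Qed.

(** * Compactness and good sets of coordinates *)

Definition bounded_fun {X : Type} (h : X -> R) : Prop := exists M, forall x, Rabs (h x) <= M.

(** Boundedness is a premise under the existential so that [sup_norm] becomes a total function. *)
Lemma sup_norm_exists {X : Type} (h : X -> R) : exists r, bounded_fun h ->
  0 <= r /\ (forall x, Rabs (h x) <= r) /\
  (forall M, 0 <= M -> (forall x, Rabs (h x) <= M) -> r <= M).
Proof.
  destruct (classic (bounded_fun h)) as [[M HM] | n]; [|exists 0; tauto].
  (* Adjoining 0 keeps the set nonempty when [X] is empty. *)
  destruct (completeness (fun r => r = 0 \/ exists x, r = Rabs (h x))) as [r [ub lub]].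
  - exists (Rmax 0 M); intros r [-> | [x ->]]; [apply Rmax_l|].
    apply Rle_trans with M; [apply HM | apply Rmax_r].
  - exists 0; auto.
  - exists r; intros _; split; [apply ub; auto | split].
    + intros x; apply ub; right; exists x; reflexivity.
    + intros M' M'0 HM'; apply lub; intros r' [-> | [x ->]]; auto.
Qed.

Definition sup_norm {X : Type} (h : X -> R) : R :=
  proj1_sig (constructive_indefinite_description _ (sup_norm_exists h)).

Lemma sup_norm_nonneg {X : Type} (h : X -> R) : bounded_fun h -> 0 <= sup_norm h.
Proof. unfold sup_norm; destruct constructive_indefinite_description; cbn; tauto. Qed.

Lemma sup_norm_ub {X : Type} (h : X -> R) x : bounded_fun h -> Rabs (h x) <= sup_norm h.
Proof.
  unfold sup_norm; destruct constructive_indefinite_description as [r hr]; cbn.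
  intros hb; apply (hr hb).
Qed.

Lemma sup_norm_le {X : Type} (h : X -> R) M :
  0 <= M -> (forall x, Rabs (h x) <= M) -> sup_norm h <= M.
Proof.
  unfold sup_norm; destruct constructive_indefinite_description as [r hr]; cbn.
  intros M0 HM; apply hr; [exists M|..]; assumption.
Qed.

Section CompactSpace.

Variables (K : Type) (t : Topology K).

Lemma rcont_of_two (f g h : K -> R) (L : R) :
  rcont t f -> rcont t g ->
  (forall x y, Rabs (h y - h x) <= L * (Rabs (f y - f x) + Rabs (g y - g x))) -> rcont t h.
Proof.
  intros cf cg H x eps eps0.
  set (d := eps / (2 * (Rabs L + 1))).
  assert (L0 := Rabs_pos L); assert (L1 := Rle_abs L).
  assert (d0 : 0 < d) by (unfold d; apply Rdiv_lt_0_compat; lra).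
  destruct (cf x d d0) as [U [oU [Ux HU]]]; destruct (cg x d d0) as [V [oV [Vx HV]]].
  exists (fun z => U z /\ V z); split; [apply open_inter; assumption|].
  split; [auto|]; intros y [Uy Vy]; specialize (HU y Uy); specialize (HV y Vy).
  apply Rle_lt_trans with (1 := H x y).
  assert (e : (Rabs L + 1) * (d + d) = eps) by (unfold d; field; lra).
  rewrite <- e.
  assert (p1 := Rabs_pos (f y - f x)); assert (p2 := Rabs_pos (g y - g x)).
  apply Rle_lt_trans with ((Rabs L + 1) * (Rabs (f y - f x) + Rabs (g y - g x))).
  - apply Rmult_le_compat_r; lra.
  - apply Rmult_lt_compat_l; lra.
Qed.

Lemma rcont_lipschitz (f h : K -> R) (L : R) :
  rcont t f -> (forall x y, Rabs (h y - h x) <= L * Rabs (f y - f x)) -> rcont t h.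
Proof.
  intros cf H; apply (rcont_of_two f f h (L / 2) cf cf).
  intros x y; specialize (H x y); lra.
Qed.

Lemma rcont_near_list {I : Type} (phi : K -> I -> R) (l : list I) w d :
  (forall i, rcont t (fun k => phi k i)) -> 0 < d ->
  exists U, is_open t U /\ U w /\
    forall y, U y -> forall i, In i l -> Rabs (phi y i - phi w i) < d.
Proof.
  intros cphi d0; induction l as [|i l [U [oU [Uw HU]]]].
  - exists (fun _ => True); split; [apply open_full | split; [exact Logic.I|]].
    intros y _ i [].
  - destruct (cphi i w d d0) as [V [oV [Vw HV]]].
    exists (fun z => U z /\ V z); split; [apply open_inter; assumption | split; [auto|]].
    intros y [Uy Vy] j [<- | jl]; [apply HV | apply HU]; assumption.
Qed.

Lemma rcont_open_neq (f : K -> R) c y : rcont t f -> f y <> c ->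
  exists U, is_open t U /\ U y /\ forall u, U u -> f u <> c.
Proof.
  intros cf ne; destruct (cf y (Rabs (f y - c))) as [U [oU [Uy HU]]].
  - apply Rabs_pos_lt; lra.
  - exists U; split; [exact oU | split; [exact Uy|]]; intros u Uu e.
    specialize (HU u Uu); rewrite e, Rabs_minus_sym in HU; lra.
Qed.

Lemma rcont_open_far (f : K -> R) c d y : rcont t f -> d < Rabs (f y - c) ->
  exists U, is_open t U /\ U y /\ forall u, U u -> d < Rabs (f u - c).
Proof.
  intros cf lt; destruct (cf y (Rabs (f y - c) - d)) as [U [oU [Uy HU]]]; [lra|].
  exists U; split; [exact oU | split; [exact Uy|]]; intros u Uu.
  specialize (HU u Uu); assert (h := Rabs_triang (f u - c) (f y - f u)).
  rewrite (Rabs_minus_sym (f y)) in h.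
  replace (f u - c + (f y - f u)) with (f y - c) in h by lra; lra.
Qed.

Lemma rcont_open_lt (f : K -> R) c d y : rcont t f -> Rabs (f y - c) < d ->
  exists U, is_open t U /\ U y /\ forall u, U u -> Rabs (f u - c) < d.
Proof.
  intros cf lt; destruct (cf y (d - Rabs (f y - c))) as [U [oU [Uy HU]]]; [lra|].
  exists U; split; [exact oU | split; [exact Uy|]]; intros u Uu.
  specialize (HU u Uu); assert (h := Rabs_triang (f u - f y) (f y - c)).
  replace (f u - f y + (f y - c)) with (f u - c) in h by lra; lra.
Qed.

Hypothesis Kcompact : tcompact t.

(** Were the intersection empty, the open sets missing some [C s] would cover [K], and a finite
    subcover would name finitely many indices without a common point. *)
Lemma compact_fip {T : Type} (C : T -> K -> Prop) :
  (forall s y, ~ C s y -> exists U, is_open t U /\ U y /\ forall u, U u -> ~ C s u) ->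
  (forall l : list T, exists y, forall s, In s l -> C s y) ->
  exists y, forall s, C s y.
Proof.
  intros closedC fip; apply NNPP; intros none.
  destruct (Kcompact (fun U => is_open t U /\ exists s, forall u, U u -> ~ C s u)) as [l [lF lcov]].
  - intros U [oU _]; exact oU.
  - intros y; apply NNPP; intros h; apply none; exists y; intros s; apply NNPP; intros nC.
    destruct (closedC s y nC) as [U [oU [Uy HU]]]; apply h; exists U; split; [|exact Uy].
    split; [exact oU | exists s; exact HU].
  - assert (pick : exists ls : list T, forall U, In U l -> exists s, In s ls /\ forall u, U u -> ~ C s u).
    { clear lcov; induction l as [|U l IH]; [exists nil; intros U []|].
      destruct IH as [ls Hls]; [intros V Vl; apply lF; right; exact Vl|].
      destruct (lF U (or_introl eq_refl)) as [_ [s Hs]].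
      exists (s :: ls); intros V [<- | Vl]; [exists s; split; [left; reflexivity | exact Hs]|].
      destruct (Hls V Vl) as [s' [h1 h2]]; exists s'; split; [right; exact h1 | exact h2]. }
    destruct pick as [ls Hls]; destruct (fip ls) as [y Hy]; destruct (lcov y) as [U [Ul Uy]].
    destruct (Hls U Ul) as [s [sl Hs]]; exact (Hs y Uy (Hy s sl)).
Qed.

Lemma rcont_bounded (f : K -> R) : rcont t f -> bounded_fun f.
Proof.
  intros cf.
  destruct (Kcompact (fun U => is_open t U /\ exists M, forall u, U u -> Rabs (f u) <= M)) as [l [lF lcov]].
  - intros U [oU _]; exact oU.
  - intros x; destruct (cf x 1 Rlt_0_1) as [U [oU [Ux HU]]]; exists U; split; [|exact Ux].
    split; [exact oU|]; exists (Rabs (f x) + 1); intros u Uu; specialize (HU u Uu).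
    assert (h := Rabs_triang (f u - f x) (f x)).
    replace (f u - f x + f x) with (f u) in h by lra; lra.
  - assert (h : exists M, forall U, In U l -> forall u, U u -> Rabs (f u) <= M).
    { clear lcov; induction l as [|U l IH]; [exists 0; intros U []|].
      destruct IH as [M HM]; [intros V Vl; apply lF; right; exact Vl|].
      destruct (lF U (or_introl eq_refl)) as [_ [N HN]].
      exists (Rmax N M); intros V [<- | Vl] u Vu.
      - apply Rle_trans with N; [auto | apply Rmax_l].
      - apply Rle_trans with M; [apply (HM V) | apply Rmax_r]; assumption. }
    destruct h as [M HM]; exists M; intros x; destruct (lcov x) as [U [Ul Ux]].
    apply (HM U); assumption.
Qed.

(** * Continuous functions and truncations in coordinates *)

Variables (I : Type) (phi : K -> I -> R).
Hypothesis phi_cont : forall i, rcont t (fun k => phi k i).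
Hypothesis phi_inj : forall k1 k2, phi k1 = phi k2 -> k1 = k2.

Lemma inv_succ_pos n : 0 < / (INR n + 1).
Proof. apply Rinv_0_lt_compat; assert (h := pos_INR n); lra. Qed.

Lemma inv_succ_le n m : (n <= m)%nat -> / (INR m + 1) <= / (INR n + 1).
Proof.
  intros h; apply le_INR in h; assert (p := pos_INR n); apply Rinv_le_contravar; lra.
Qed.

Lemma inv_succ_lt eps : 0 < eps -> exists n, / (INR n + 1) < eps.
Proof.
  intros e0; destruct (archimed_cor1 eps e0) as [[|n] [h hn]]; [lia|].
  exists n; rewrite S_INR in h; exact h.
Qed.

Lemma zero_of_small r : (forall n, Rabs r <= / (INR n + 1)) -> r = 0.
Proof.
  intros h; apply NNPP; intros ne; destruct (inv_succ_lt (Rabs r)) as [n hn].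
  - apply Rabs_pos_lt, ne.
  - specialize (h n); lra.
Qed.

(** If no box around [w] works, the closed conditions [C] have the finite intersection property. A
    common point has the coordinates of [w], so it is [w] by injectivity, yet [f] differs there from
    [f w] by at least [eps]. *)
Lemma rcont_box (f : K -> R) w eps : rcont t f -> 0 < eps ->
  exists (l : list I) d, 0 < d /\
    forall y, (forall i, In i l -> Rabs (phi y i - phi w i) < d) -> Rabs (f y - f w) < eps.
Proof.
  intros cf e0.
  set (C := fun (s : option (I * nat)) y => match s with
     | None => ~ Rabs (f y - f w) < eps
     | Some (i, n) => ~ / (INR n + 1) < Rabs (phi y i - phi w i) end).
  destruct (classic (exists ls, forall y, exists s, In s ls /\ ~ C s y)) as [[ls Hls] | none].
  - exists (flat_map (fun s => match s with None => nil | Some (i, _) => i :: nil end) ls).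
    assert (dmin : exists d, 0 < d /\ forall i n, In (Some (i, n)) ls -> d <= / (INR n + 1)).
    { clear Hls; induction ls as [|[[i n]|] ls [d [d0 Hd]]].
      - exists 1; split; [lra | intros i n []].
      - exists (Rmin d (/ (INR n + 1))); split.
        + apply Rmin_glb_lt; [exact d0 | apply inv_succ_pos].
        + intros j m [e | jl]; [inversion e; subst; apply Rmin_r|].
          apply Rle_trans with d; [apply Rmin_l | eapply Hd; exact jl].
      - exists d; split; [exact d0|]; intros i n [e | h]; [discriminate | eapply Hd; exact h]. }
    destruct dmin as [d [d0 Hd]]; exists d; split; [exact d0|].
    intros y Hy; destruct (Hls y) as [[[i n]|] [sl ns]].
    + exfalso; apply ns; cbn; intros lt.
      assert (h : Rabs (phi y i - phi w i) < d).
      { apply Hy, in_flat_map; exists (Some (i, n)); split; [exact sl | left; reflexivity]. }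
      specialize (Hd i n sl); lra.
    + apply NNPP; exact ns.
  - exfalso; destruct (compact_fip C) as [y Hy].
    + intros [[i n]|] y h; cbn in h |- *; apply NNPP in h.
      * destruct (rcont_open_far _ _ _ y (phi_cont i) h) as [U [oU [Uy HU]]].
        exists U; split; [exact oU | split; [exact Uy|]]; intros u Uu h'; apply h', HU, Uu.
      * destruct (rcont_open_lt _ _ _ y cf h) as [U [oU [Uy HU]]].
        exists U; split; [exact oU | split; [exact Uy|]]; intros u Uu h'; apply h', HU, Uu.
    + intros ls; apply NNPP; intros h; apply none; exists ls; intros y; apply NNPP; intros h'.
      apply h; exists y; intros s sl; apply NNPP; intros nC; apply h'; exists s; auto.
    + assert (e : y = w).
      { apply phi_inj, functional_extensionality; intros i.
        apply Rminus_diag_uniq, zero_of_small; intros n; specialize (Hy (Some (i, n))); cbn in Hy; lra. }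
      apply (Hy None); cbn; rewrite e, Rminus_diag, Rabs_R0; exact e0.
Qed.

(** Cover [K] by boxes for [eps / 2]. A point [z] agreeing with [y] on the coordinates of a box
    around [y] satisfies the same box inequalities; the lists of a finite subcover are
    concatenated. *)
Lemma rcont_finitely_determined (f : K -> R) eps : rcont t f -> 0 < eps ->
  exists l : list I,
    forall y z, (forall i, In i l -> phi y i = phi z i) -> Rabs (f y - f z) < eps.
Proof.
  intros cf e0.
  set (det := fun (U : K -> Prop) (l : list I) =>
    forall y z, U y -> (forall i, In i l -> phi y i = phi z i) -> Rabs (f y - f z) < eps).
  destruct (Kcompact (fun U => is_open t U /\ exists l, det U l)) as [L [LF Lcov]].
  - intros U [oU _]; exact oU.
  - intros w; destruct (rcont_box f w (eps / 2) cf) as [l [d [d0 Hl]]]; [lra|].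
    destruct (rcont_near_list phi l w d phi_cont d0) as [U [oU [Uw HU]]].
    exists U; split; [|exact Uw]; split; [exact oU|]; exists l; intros y z Uy yz.
    assert (hy := Hl y (HU y Uy)).
    assert (hz : Rabs (f z - f w) < eps / 2).
    { apply Hl; intros i il; rewrite <- yz by exact il; apply HU; assumption. }
    assert (h := Rabs_triang (f y - f w) (f w - f z)).
    replace (f y - f w + (f w - f z)) with (f y - f z) in h by lra.
    rewrite (Rabs_minus_sym (f w)) in h; lra.
  - assert (h : exists l, forall U, In U L -> det U l).
    { clear Lcov; induction L as [|U L IH]; [exists nil; intros U []|].
      destruct IH as [l Hl]; [intros V VL; apply LF; right; exact VL|].
      destruct (LF U (or_introl eq_refl)) as [_ [l' Hl']].
      exists (l' ++ l); intros V [<- | VL] y z Vy yz.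
      - apply Hl'; [exact Vy|]; intros i il; apply yz, in_or_app; auto.
      - apply (Hl V VL); [exact Vy|]; intros i il; apply yz, in_or_app; auto. }
    destruct h as [l Hl]; exists l; intros y z yz; destruct (Lcov y) as [U [UL Uy]].
    apply (Hl U UL); assumption.
Qed.

(* [J] is good when truncating any point of [K] to the coordinates in [J] stays in [K]. *)
Definition good (J : I -> Prop) : Prop :=
  forall z, exists w, (forall i, J i -> phi w i = phi z i) /\ (forall i, ~ J i -> phi w i = 0).

(** The truncation of [z] is a common point of closed conditions, one for each coordinate and
    precision; the approximations provide the finite intersection property. *)
Lemma good_of_approximations (J : I -> Prop) :
  (forall z (l : list (I * nat)), exists w, (forall i, ~ J i -> phi w i = 0) /\
     forall i n, In (i, n) l -> J i -> Rabs (phi w i - phi z i) < / (INR n + 1)) -> good J.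
Proof.
  intros H z.
  destruct (compact_fip (fun (s : I * nat) y =>
      (J (fst s) -> ~ / (INR (snd s) + 1) < Rabs (phi y (fst s) - phi z (fst s))) /\
      (~ J (fst s) -> ~ phi y (fst s) <> 0))) as [w Hw].
  - intros [i n] y h; cbn in h |- *.
    destruct (classic (J i)) as [Ji | nJ].
    + destruct (rcont_open_far _ (phi z i) (/ (INR n + 1)) y (phi_cont i)) as [U [oU [Uy HU]]].
      { apply NNPP; intros h'; apply h; split; [intros _; exact h' | tauto]. }
      exists U; split; [exact oU | split; [exact Uy|]]; intros u Uu [h1 _].
      apply (h1 Ji), HU, Uu.
    + destruct (rcont_open_neq _ 0 y (phi_cont i)) as [U [oU [Uy HU]]].
      { intros e; apply h; split; [tauto | intros _ h'; exact (h' e)]. }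
      exists U; split; [exact oU | split; [exact Uy|]]; intros u Uu [_ h1].
      apply (h1 nJ), HU, Uu.
  - intros l; destruct (H z l) as [w [off near]]; exists w; intros [i n] il; cbn; split.
    + intros Ji; specialize (near i n il Ji); lra.
    + intros nJ h; apply h, off, nJ.
  - exists w; split; intros i hi.
    + apply Rminus_diag_uniq, zero_of_small; intros n; destruct (Hw (i, n)) as [h _].
      specialize (h hi); cbn in h; lra.
    + apply NNPP; destruct (Hw (i, 0%nat)) as [_ h]; exact (h hi).
Qed.

(** Iterated unpairing: a natural codes a stream of naturals, and every finite sequence begins such
    a stream. *)
Fixpoint digit_of (c k : nat) : nat :=
  match k with O => fst (of_nat c) | S k => digit_of (snd (of_nat c)) k end.

Lemma digit_of_onto n : forall v : nat -> nat, exists c, forall k, (k < n)%nat -> digit_of c k = v k.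
Proof.
  induction n as [|n IH]; intros v; [exists 0%nat; lia|].
  destruct (IH (fun k => v (S k))) as [c Hc].
  exists (to_nat (v 0%nat, c)); intros [|k] hk; cbn [digit_of]; rewrite cancel_of_to; [reflexivity|].
  apply Hc; lia.
Qed.

Lemma R_separable : exists q : nat -> R, forall x eps, 0 < eps -> exists n, Rabs (q n - x) < eps.
Proof.
  exists (fun n => let (a, m) := of_nat n in
           (INR (fst (of_nat a)) - INR (snd (of_nat a))) / (INR m + 1)).
  intros x eps e0; destruct (inv_succ_lt eps e0) as [m hm].
  (* [IZR N / (INR m + 1)] exceeds [x] by at most [/ (INR m + 1)]; the integer [N] is coded as a
     difference of two naturals. *)
  set (N := up (x * (INR m + 1))).
  exists (to_nat (to_nat (Z.to_nat N, Z.to_nat (- N)), m)); rewrite !cancel_of_to; cbn [fst snd].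
  assert (e : INR (Z.to_nat N) - INR (Z.to_nat (- N)) = IZR N).
  { rewrite !INR_IZR_INZ, <- minus_IZR; f_equal; lia. }
  rewrite e; destruct (archimed (x * (INR m + 1))) as [h1 h2]; fold N in h1, h2.
  assert (p := pos_INR m).
  replace (IZR N / (INR m + 1) - x) with ((IZR N - x * (INR m + 1)) / (INR m + 1)) by (field; lra).
  unfold Rdiv; rewrite Rabs_mult, (Rabs_pos_eq (/ _)) by (apply Rlt_le, inv_succ_pos).
  rewrite Rabs_pos_eq by lra.
  apply Rle_lt_trans with (1 * / (INR m + 1)); [|lra].
  apply Rmult_le_compat_r; [apply Rlt_le, inv_succ_pos | lra].
Qed.

(** * Countable good sets of coordinates *)

Variable A : K -> Prop.
Hypothesis A_dense : tdense t A.
Hypothesis A_sigma : forall k, A k <-> Sigma_I I (phi k).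
Variable k0 : K.

(** [D] is indexed by a precision [n] and a code [c] of values from a countable dense set of reals.
    It picks a point of [A] near these values on the first [n] coordinates if there is one; density
    of [A] provides one when the values approximate those of [z]. *)
Lemma dense_on_countable_coordinates (e : nat -> I) :
  exists D : nat -> K, (forall m, A (D m)) /\
    forall z n, exists m, forall k, (k < n)%nat -> Rabs (phi (D m) (e k) - phi z (e k)) < / (INR n + 1).
Proof.
  destruct R_separable as [q Hq].
  destruct (A_dense (fun _ => True) (open_full _ t)) as [a0 [_ Aa0]]; [exists k0; exact Logic.I|].
  destruct (choice_ex (fun (nc : nat) a => A a /\
     forall n c, of_nat nc = (n, c) ->
       (exists b, A b /\ forall k, (k < n)%nat -> Rabs (phi b (e k) - q (digit_of c k)) < / 2 * / (INR n + 1)) ->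
       forall k, (k < n)%nat -> Rabs (phi a (e k) - q (digit_of c k)) < / 2 * / (INR n + 1))) as [D HD].
  - intros nc; destruct (of_nat nc) as [n c].
    destruct (classic (exists b, A b /\ forall k, (k < n)%nat ->
        Rabs (phi b (e k) - q (digit_of c k)) < / 2 * / (INR n + 1))) as [[b [Ab Hb]] | none].
    + exists b; split; [exact Ab|]; intros n' c' E _; inversion E; subst; exact Hb.
    + exists a0; split; [exact Aa0|]; intros n' c' E h; inversion E; subst; contradiction.
  - exists D; split; [intros m; apply HD|]; intros z n.
    assert (pos := inv_succ_pos n); set (eps := / (INR n + 1)) in *.
    destruct (choice_ex (fun k v => Rabs (q v - phi z (e k)) < eps / 4)) as [v Hv].
    { intros k; apply Hq; lra. }
    destruct (digit_of_onto n v) as [c Hc].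
    exists (to_nat (n, c)); intros k kn.
    destruct (HD (to_nat (n, c))) as [_ h]; specialize (h n c (cancel_of_to (n, c))).
    assert (near : exists b, A b /\ forall k, (k < n)%nat ->
                Rabs (phi b (e k) - q (digit_of c k)) < / 2 * / (INR n + 1)).
    { destruct (rcont_near_list phi (map e (seq 0 n)) z (eps / 4) phi_cont) as [U [oU [Uz HU]]]; [lra|].
      destruct (A_dense U oU (ex_intro _ z Uz)) as [b [Ub Ab]]; exists b; split; [exact Ab|].
      intros j jn; rewrite Hc by exact jn; fold eps.
      assert (h1 : Rabs (phi b (e j) - phi z (e j)) < eps / 4).
      { apply HU; [exact Ub | apply in_map, in_seq; lia]. }
      specialize (Hv j); rewrite Rabs_minus_sym in Hv.
      assert (tri := Rabs_triang (phi b (e j) - phi z (e j)) (phi z (e j) - q (v j))).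
      replace (phi b (e j) - phi z (e j) + (phi z (e j) - q (v j))) with (phi b (e j) - q (v j)) in tri by lra.
      lra. }
    specialize (h near k kn); rewrite Hc in h by exact kn; fold eps in h.
    specialize (Hv k).
    assert (tri := Rabs_triang (phi (D (to_nat (n, c))) (e k) - q (v k)) (q (v k) - phi z (e k))).
    replace (phi (D (to_nat (n, c))) (e k) - q (v k) + (q (v k) - phi z (e k)))
      with (phi (D (to_nat (n, c))) (e k) - phi z (e k)) in tri by lra.
    lra.
Qed.

(* Closing [P] under the supports of points of [A] that approximate every point of [K] on finite
   sets of coordinates makes truncations limits of points of [A] supported in [J]. *)
Lemma good_extension (P : I -> Prop) : countable_set P ->
  exists J, countable_set J /\ (forall i, P i -> J i) /\ good J.
Proof.
  intros [e0 He0].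
  (* [e'] enumerates the range of [e] together with the supports of the countably many points of [A]
     that approximate on [e]. *)
  destruct (choice_ex (fun e e' : nat -> I => (forall k, exists k', e' k' = e k) /\
    forall z n, exists a, (forall i, phi a i <> 0 -> exists k', e' k' = i) /\
      forall k, (k < n)%nat -> Rabs (phi a (e k) - phi z (e k)) < / (INR n + 1))) as [next Hnext].
  { intros e; destruct (dense_on_countable_coordinates e) as [D [AD HD]].
    destruct (countable_or (fun i => exists k, e k = i) (fun i => exists m, phi (D m) i <> 0)) as [e' He'].
    - apply countable_range.
    - apply countable_union; intros m; apply A_sigma, AD.
    - exists e'; split.
      + intros k; apply He'; left; exists k; reflexivity.
      + intros z n; destruct (HD z n) as [m Hm]; exists (D m); split; [|exact Hm].
        intros i hi; apply He'; right; exists m; exact hi. }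
  set (E := fix E n := match n with O => e0 | S n => next (E n) end).
  assert (mono : forall n n', (n <= n')%nat -> forall k, exists k', E n' k' = E n k).
  { intros n n' h; induction h as [|n' _ IH]; intros k; [exists k; reflexivity|].
    destruct (IH k) as [k' <-]; apply (proj1 (Hnext (E n'))). }
  exists (fun i => exists n k, E n k = i); split; [|split].
  - apply countable_union; intros n; apply countable_range.
  - intros i Pi; exists 0%nat; apply He0, Pi.
  - apply good_of_approximations; intros z l.
    (* One stage [N] enumerates all coordinates of [l] in [J], at positions below an [n'] that also
       bounds the precisions asked of them. The point of [A] found for [E N] then works, its support
       being enumerated by [E (S N)]. *)
    assert (unif : exists N n', forall i n, In (i, n) l -> (exists n k, E n k = i) ->
        (n <= n')%nat /\ exists k, (k < n')%nat /\ E N k = i).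
    { induction l as [|[i n] l [N [n' IH]]]; [exists 0%nat, 0%nat; intros i n []|].
      assert (lift : forall N1 n1, (N <= N1)%nat -> exists n2, (n1 <= n2)%nat /\
         forall j m, In (j, m) l -> (exists n k, E n k = j) -> (m <= n2)%nat /\ exists k, (k < n2)%nat /\ E N1 k = j).
      { intros N1 n1 hN; clear - IH mono hN.
        destruct (choice_ex _ (mono N N1 hN)) as [f Hf].
        assert (b : exists b, forall k, (k < n')%nat -> (f k < b)%nat).
        { clear; induction n' as [|m [b Hb]]; [exists 0%nat; lia|].
          exists (S (f m) + b)%nat; intros k hk; destruct (Nat.eq_dec k m) as [-> | ne]; [lia|].
          specialize (Hb k); lia. }
        destruct b as [b Hb]; exists (n1 + n' + b)%nat; split; [lia|].
        intros j m jl Jj; destruct (IH j m jl Jj) as [h1 [k [h2 h3]]]; split; [lia|].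
        exists (f k); split; [specialize (Hb k h2); lia | rewrite Hf; exact h3]. }
      destruct (classic (exists n k, E n k = i)) as [[N0 [k0' Hk]] | no].
      - destruct (mono N0 (N0 + N)%nat ltac:(lia) k0') as [k1 Hk1].
        destruct (lift (N0 + N)%nat (S (k1 + n)) ltac:(lia)) as [n2 [hn2 H2]].
        exists (N0 + N)%nat, n2; intros j m [e | jl] Jj; [|apply H2; assumption].
        inversion e; subst j m; split; [lia|]; exists k1; split; [lia|congruence].
      - exists N, n'; intros j m [e | jl] Jj; [|apply IH; assumption].
        inversion e; subst; contradiction. }
    destruct unif as [N [n' Hn']].
    destruct (proj2 (Hnext (E N)) z n') as [a [off near]].
    exists a; split.
    + intros i nJ; apply NNPP; intros ne; destruct (off i ne) as [k' Hk'].
      apply nJ; exists (S N), k'; exact Hk'.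
    + intros i n il Ji; destruct (Hn' i n il Ji) as [h1 [k [h2 <-]]].
      apply Rlt_le_trans with (1 := near k h2); apply inv_succ_le, h1.
Qed.

End CompactSpace.

(** * Jumps along a chain of coordinate sets *)

Lemma Rmin_1_lipschitz a b : Rabs (Rmin 1 a - Rmin 1 b) <= Rabs (a - b).
Proof.
  unfold Rmin, Rabs; destruct (Rle_dec 1 a), (Rle_dec 1 b);
    repeat destruct Rcase_abs; lra.
Qed.

Lemma Rmax_0_lipschitz a b : Rabs (Rmax 0 a - Rmax 0 b) <= Rabs (a - b).
Proof.
  unfold Rmax, Rabs; destruct (Rle_dec 0 a), (Rle_dec 0 b);
    repeat destruct Rcase_abs; lra.
Qed.

Section SigmaSubset.

Variables (K : Type) (t : Topology K) (I : Type) (phi : K -> I -> R) (A : K -> Prop).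
Hypothesis phi_cont : forall i, rcont t (fun k => phi k i).
Hypothesis phi_inj : forall k1 k2, phi k1 = phi k2 -> k1 = k2.
Hypothesis A_sigma : forall k, A k <-> Sigma_I I (phi k).

(** A nonzero coordinate of the limit is nonzero at some term, so the support of [x] lies in a
    countable union of countable supports. *)
Lemma Sigma_subset_seq_closed (s : nat -> K) x :
  (forall n, A (s n)) -> tconverges t s x -> A x.
Proof.
  intros As sx; apply A_sigma.
  apply (countable_subset _ (fun i => exists n, phi (s n) i <> 0)).
  - intros i hi; destruct (rcont_open_neq K t _ 0 x (phi_cont i) hi) as [U [oU [Ux HU]]].
    destruct (sx U oU Ux) as [N HN]; exists N; apply HU, HN; lia.
  - apply countable_union; intros n; apply A_sigma, As.
Qed.

(** [psi] is a weighted supremum distance to [x] on the coordinates [k m]. The weights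
    [/ (INR m + 1)] tend to 0, so up to any error only finitely many coordinates matter, whence
    continuity. *)
Lemma countable_separation (k : nat -> I) x :
  exists psi : K -> R, rcont t psi /\ psi x = 0 /\ (forall z, 0 <= psi z) /\
    (forall m z, phi z (k m) <> phi x (k m) -> 0 < psi z) /\
    (forall z w, (forall m, phi z (k m) = phi w (k m)) -> psi z = psi w).
Proof.
  set (u := fun z m => Rmin 1 (Rabs (phi z (k m) - phi x (k m))) * / (INR m + 1)).
  assert (u_nonneg : forall z m, 0 <= u z m).
  { intros z m; apply Rmult_le_pos; [|apply Rlt_le, inv_succ_pos].
    apply Rmin_glb; [lra | apply Rabs_pos]. }
  assert (u_le : forall z m, u z m <= / (INR m + 1)).
  { intros z m; rewrite <- Rmult_1_l; apply Rmult_le_compat_r; [apply Rlt_le, inv_succ_pos | apply Rmin_l]. }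
  assert (inv1 : forall m, / (INR m + 1) <= 1).
  { intros m; replace 1 with (/ (INR 0 + 1)) at 2 by (cbn; field); apply inv_succ_le; lia. }
  assert (bnd : forall z, bounded_fun (u z)).
  { intros z; exists 1; intros m; rewrite Rabs_pos_eq by apply u_nonneg.
    apply Rle_trans with (1 := u_le z m), inv1. }
  assert (close : forall y z e, (forall m, Rabs (u y m - u z m) <= e) -> sup_norm (u y) <= sup_norm (u z) + e).
  { intros y z e h; assert (e0 : 0 <= e) by (apply Rle_trans with (2 := h 0%nat); apply Rabs_pos).
    assert (s0 := sup_norm_nonneg _ (bnd z)).
    apply sup_norm_le; [lra|]; intros m; assert (h1 := sup_norm_ub _ m (bnd z)); specialize (h m).
    assert (tri := Rabs_triang (u y m - u z m) (u z m)).
    replace (u y m - u z m + u z m) with (u y m) in tri by lra; lra. }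
  exists (fun z => sup_norm (u z)); split; [|split; [|split; [|split]]].
  - intros z e e0; destruct (inv_succ_lt (e / 2)) as [n hn]; [lra|].
    destruct (rcont_near_list K t phi (map k (seq 0 n)) z (e / 2) phi_cont) as [U [oU [Uz HU]]]; [lra|].
    exists U; split; [exact oU | split; [exact Uz|]]; intros y Uy.
    assert (h : forall m, Rabs (u y m - u z m) <= e / 2).
    { intros m; destruct (Nat.lt_ge_cases m n) as [mn | nm].
      - assert (h1 : Rabs (phi y (k m) - phi z (k m)) < e / 2).
        { apply HU; [exact Uy | apply in_map, in_seq; lia]. }
        unfold u; rewrite <- Rmult_minus_distr_r, Rabs_mult.
        rewrite (Rabs_pos_eq (/ _)) by apply Rlt_le, inv_succ_pos.
        rewrite <- (Rmult_1_r (e / 2)).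
        apply Rmult_le_compat; [apply Rabs_pos | apply Rlt_le, inv_succ_pos | | apply inv1].
        apply Rle_trans with (1 := Rmin_1_lipschitz _ _).
        apply Rle_trans with (1 := Rabs_triang_inv2 _ _).
        replace (phi y (k m) - phi x (k m) - (phi z (k m) - phi x (k m)))
          with (phi y (k m) - phi z (k m)) by lra; lra.
      - assert (h1 := u_nonneg y m); assert (h2 := u_nonneg z m).
        assert (h3 := u_le y m); assert (h4 := u_le z m); assert (h5 := inv_succ_le n m nm).
        apply Rabs_le; lra. }
    assert (h1 := close y z _ h).
    assert (h2 : sup_norm (u z) <= sup_norm (u y) + e / 2).
    { apply close; intros m; rewrite Rabs_minus_sym; apply h. }
    apply Rabs_def1; lra.
  - apply Rle_antisym; [|apply sup_norm_nonneg, bnd].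
    apply sup_norm_le; [lra|]; intros m; unfold u.
    rewrite Rminus_diag, Rabs_R0, Rmin_right, Rmult_0_l, Rabs_R0; lra.
  - intros z; apply sup_norm_nonneg, bnd.
  - intros m z ne; apply Rlt_le_trans with (2 := sup_norm_ub _ m (bnd z)).
    rewrite Rabs_pos_eq by apply u_nonneg.
    apply Rmult_lt_0_compat; [|apply inv_succ_pos].
    apply Rmin_glb_lt; [lra | apply Rabs_pos_lt; lra].
  - intros z w h; f_equal; apply functional_extensionality; intros m; unfold u; rewrite h; reflexivity.
Qed.

(** Each term of [s] other than [x] is separated from [x] by a coordinate [e m], so [psi] is
    positive there. If no points outside [A] had arbitrarily small positive [psi], the terms near
    [x] and different from it would lie in [A], and so would [x]. *)
Lemma disjoint_bumps x (s : nat -> K) :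
  ~ A x -> nontrivial_seq s -> tconverges t s x ->
  exists (e : nat -> I) (y : nat -> K) (g : nat -> K -> R),
    (forall n, ~ A (y n)) /\ (forall n, rcont t (g n)) /\ (forall n z, 0 <= g n z <= 1) /\
    (forall n, g n (y n) = 1) /\ (forall n m z, n <> m -> g n z = 0 \/ g m z = 0) /\
    (forall n z w, (forall k, phi z (e k) = phi w (e k)) -> g n z = g n w).
Proof.
  intros nAx nontriv sx.
  assert (often : forall n, exists m, (n <= m)%nat /\ s m <> x).
  { intros n; apply NNPP; intros none; apply nontriv; exists n; intros m nm.
    assert (h : forall m, (n <= m)%nat -> s m = x).
    { intros m' h; apply NNPP; intros ne; apply none; exists m'; auto. }
    rewrite !h by lia; reflexivity. }
  assert (sep : forall z, z <> x -> exists i, phi z i <> phi x i).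
  { intros z ne; apply NNPP; intros none; apply ne, phi_inj, functional_extensionality.
    intros i; apply NNPP; intros h; apply none; exists i; exact h. }
  destruct (often 0%nat) as [m0 [_ ne0]]; destruct (sep _ ne0) as [i0 _].
  destruct (choice_ex (fun m i => s m <> x -> phi (s m) i <> phi x i)) as [e He].
  { intros m; destruct (classic (s m = x)) as [h | h]; [exists i0; contradiction|].
    destruct (sep _ h) as [i Hi]; exists i; auto. }
  destruct (countable_separation e x) as [psi [psi_cont [psi_x [psi_nonneg [psi_pos psi_dep]]]]].
  assert (small : forall d, exists y, 0 < d -> ~ A y /\ 0 < psi y < d).
  { intros d; apply NNPP; intros none; apply nAx.
    assert (d0 : 0 < d).
    { apply NNPP; intros h; apply none; exists x; intros h'; contradiction. }
    destruct (psi_cont x d d0) as [U [oU [Ux HU]]]; destruct (sx U oU Ux) as [N HN].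
    destruct (choice_ex _ often) as [f Hf].
    apply (Sigma_subset_seq_closed (fun n => s (f (N + n)%nat))).
    - intros n; destruct (Hf (N + n)%nat) as [h1 h2]; apply NNPP; intros nA.
      apply none; eexists; intros _; split; [exact nA|]; split.
      + apply (psi_pos (f (N + n)%nat)), He, h2.
      + assert (h := HU _ (HN (f (N + n)%nat) ltac:(lia))); rewrite psi_x, Rminus_0_r in h.
        apply Rle_lt_trans with (2 := h), Rle_abs.
    - intros V oV Vx; destruct (sx V oV Vx) as [N' HN']; exists N'; intros n hn.
      apply HN'; destruct (Hf (N + n)%nat); lia. }
  destruct (choice_ex _ small) as [pick Hpick].
  set (y := fix y n := match n with O => pick 1 | S n => pick (psi (y n) / 2) end).
  assert (ypos : forall n, ~ A (y n) /\ 0 < psi (y n)).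
  { induction n as [|n [_ IH]].
    - destruct (Hpick 1 Rlt_0_1) as [h1 h2]; split; [exact h1 | apply h2].
    - destruct (Hpick (psi (y n) / 2)) as [h1 h2]; [lra | split; [exact h1 | apply h2]]. }
  assert (ydec : forall n m, (n < m)%nat -> psi (y m) < psi (y n) / 2).
  { assert (one : forall n, psi (y (S n)) < psi (y n) / 2).
    { intros n; apply (Hpick (psi (y n) / 2)); destruct (ypos n); lra. }
    induction 1 as [|m _ IH]; [apply one|].
    specialize (one m); destruct (ypos m); lra. }
  (* The bump [g n] vanishes unless [psi z] is within a quarter of [psi (y n)] from it; as these
     values more than halve at each step, the supports are disjoint. *)
  exists e, y, (fun n z => Rmax 0 (1 - 4 / psi (y n) * Rabs (psi z - psi (y n)))).
  split; [apply ypos | split; [|split; [|split; [|split]]]].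
  - intros n; destruct (ypos n) as [_ p].
    apply (rcont_lipschitz K t psi _ (4 / psi (y n)) psi_cont); intros z w.
    apply Rle_trans with (1 := Rmax_0_lipschitz _ _).
    replace (_ - _ - (_ - _)) with
      (4 / psi (y n) * (Rabs (psi z - psi (y n)) - Rabs (psi w - psi (y n)))) by lra.
    assert (q : 0 < 4 / psi (y n)) by (apply Rdiv_lt_0_compat; lra).
    rewrite Rabs_mult, (Rabs_pos_eq (4 / _)) by lra.
    apply Rmult_le_compat_l; [lra|].
    apply Rle_trans with (1 := Rabs_triang_inv2 _ _).
    replace (psi z - psi (y n) - (psi w - psi (y n))) with (psi z - psi w) by lra.
    rewrite Rabs_minus_sym; lra.
  - intros n z; destruct (ypos n) as [_ p].
    assert (q : 0 < 4 / psi (y n)) by (apply Rdiv_lt_0_compat; lra).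
    assert (h := Rmult_le_pos _ _ (Rlt_le _ _ q) (Rabs_pos (psi z - psi (y n)))).
    split; [apply Rmax_l | apply Rmax_lub; lra].
  - intros n; rewrite Rminus_diag, Rabs_R0, Rmult_0_r, Rminus_0_r, Rmax_right; lra.
  - assert (zero : forall n z, psi (y n) / 4 <= Rabs (psi z - psi (y n)) ->
              Rmax 0 (1 - 4 / psi (y n) * Rabs (psi z - psi (y n))) = 0).
    { intros n z h; destruct (ypos n) as [_ p]; apply Rmax_left.
      assert (q : 0 < 4 / psi (y n)) by (apply Rdiv_lt_0_compat; lra).
      assert (r := Rmult_le_compat_l _ _ _ (Rlt_le _ _ q) h).
      replace (4 / psi (y n) * (psi (y n) / 4)) with 1 in r by (field; lra); lra. }
    assert (wlog : forall n m z, (n < m)%nat ->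
        psi (y n) / 4 <= Rabs (psi z - psi (y n)) \/ psi (y m) / 4 <= Rabs (psi z - psi (y m))).
    { intros n m z nm; specialize (ydec n m nm); destruct (ypos n), (ypos m).
      unfold Rabs; destruct Rcase_abs, Rcase_abs; lra. }
    intros n m z ne; destruct (Nat.lt_total n m) as [h | [h | h]]; [|contradiction|].
    + destruct (wlog n m z h); [left | right]; apply zero; assumption.
    + destruct (wlog m n z h); [right | left]; apply zero; assumption.
  - intros n z w h; rewrite (psi_dep z w h); reflexivity.
Qed.

Hypothesis Kcompact : tcompact t.
Hypothesis A_dense : tdense t A.

(** The recursion builds pairs [(P, Q)] of good sets; [a i] and [b i] truncate [y i] to them, so
    they differ only on [Q] minus [P]. Each [P] contains all earlier [Q], so these differences are
    pairwise disjoint. Each [P] also contains [e], where neither truncation changes [y i]. *)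
Lemma coordinate_chain {W : Type} (lt : W -> W -> Prop) (e : nat -> I) (y : W -> K) :
  omega1_like lt -> (forall i, ~ A (y i)) ->
  exists (k : W -> I) (a b : W -> K),
    (forall i n, phi (a i) (e n) = phi (y i) (e n) /\ phi (b i) (e n) = phi (y i) (e n)) /\
    (forall i, phi (y i) (k i) <> 0 /\ phi (a i) (k i) = 0 /\ phi (b i) (k i) = phi (y i) (k i)) /\
    (forall c i j, phi (a i) c <> phi (b i) c -> phi (a j) c <> phi (b j) c -> i = j).
Proof.
  intros ol nA.
  destruct (wf_choice lt (fun i (g : W -> (I -> Prop) * (I -> Prop)) PQ =>
    good K I phi (fst PQ) /\ good K I phi (snd PQ) /\ countable_set (snd PQ) /\
    (forall c, fst PQ c -> snd PQ c) /\ (forall n, fst PQ (e n)) /\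
    (forall j, lt j i -> forall c, snd (g j) c -> fst PQ c) /\
    exists c, snd PQ c /\ ~ fst PQ c /\ phi (y i) c <> 0) (fun _ => True, fun _ => True)) as [J HJ].
  - apply (ol_wf lt ol).
  - intros i g g' PQ eq [h1 [h2 [h3 [h4 [h5 [h6 h7]]]]]]; repeat (split; [assumption|]).
    split; [|exact h7]; intros j ji; rewrite <- eq by exact ji; exact (h6 j ji).
  - intros i g Hg; destruct (ol_seg lt ol i) as [f Hf].
    destruct (good_extension K t Kcompact I phi phi_cont A A_dense A_sigma (y i)
      (fun c => (exists n, e n = c) \/ exists n, lt (f n) i /\ snd (g (f n)) c)) as [P [cP [sP gP]]].
    { apply countable_or; [apply countable_range|]; apply countable_union; intros n.
      destruct (classic (lt (f n) i)) as [h | h].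
      - apply (countable_subset _ (snd (g (f n)))); [tauto|]; apply (Hg _ h).
      - exists e; intros c [h' _]; contradiction. }
    (* Otherwise the support of [y i] would lie in the countable [P], putting [y i] in [A]. *)
    assert (new : exists c, ~ P c /\ phi (y i) c <> 0).
    { apply NNPP; intros none; apply (nA i), A_sigma.
      apply (countable_subset _ P); [|exact cP]; intros c hc; apply NNPP; intros nP.
      apply none; exists c; auto. }
    destruct new as [c [nPc hc]].
    destruct (good_extension K t Kcompact I phi phi_cont A A_dense A_sigma (y i)
      (fun c' => P c' \/ c = c')) as [Q [cQ [sQ gQ]]].
    { apply countable_or; [exact cP|]; exists (fun _ => c); intros c' <-; exists 0%nat; reflexivity. }
    exists (P, Q); cbn; split; [exact gP | split; [exact gQ | split; [exact cQ |]]].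
    split; [intros c' h; apply sQ; auto|].
    split; [intros n; apply sP; left; exists n; reflexivity|].
    split; [|exists c; split; [apply sQ; auto | auto]].
    intros j ji c' h; apply sP; right; destruct (Hf j ji) as [n <-]; exists n; auto.
  - destruct (choice_ex (fun i c => snd (J i) c /\ ~ fst (J i) c /\ phi (y i) c <> 0)) as [k Hk].
    { intros i; apply (HJ i). }
    destruct (choice_ex (fun i w => (forall c, fst (J i) c -> phi w c = phi (y i) c) /\
                                    (forall c, ~ fst (J i) c -> phi w c = 0))) as [a Ha].
    { intros i; apply (HJ i). }
    destruct (choice_ex (fun i w => (forall c, snd (J i) c -> phi w c = phi (y i) c) /\
                                    (forall c, ~ snd (J i) c -> phi w c = 0))) as [b Hb].
    { intros i; destruct (HJ i) as [_ [h _]]; apply h. }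
    assert (sub : forall i c, fst (J i) c -> snd (J i) c) by (intros i; apply (HJ i)).
    assert (range_e : forall i n, fst (J i) (e n)) by (intros i; apply (HJ i)).
    assert (incr : forall i j, lt j i -> forall c, snd (J j) c -> fst (J i) c) by (intros i; apply (HJ i)).
    exists k, a, b; split; [|split].
    + intros i n; split; [apply Ha | apply Hb, sub]; apply range_e.
    + intros i; destruct (Hk i) as [h1 [h2 h3]]; split; [exact h3|].
      split; [apply Ha, h2 | apply Hb, h1].
    + assert (diff : forall i c, phi (a i) c <> phi (b i) c -> snd (J i) c /\ ~ fst (J i) c).
      { intros i c ne; split; intros h || (apply NNPP; intros h); apply ne.
        - destruct (Ha i) as [_ ha]; destruct (Hb i) as [_ hb].
          rewrite hb by exact h; apply ha; intros h'; apply h, sub, h'.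
        - destruct (Ha i) as [ha _]; destruct (Hb i) as [hb _].
          rewrite hb by (apply sub, h); apply ha, h. }
      intros c i j hi hj; apply diff in hi, hj.
      destruct (ol_total lt ol i j) as [h | [h | h]]; [|exact h|]; exfalso.
      * apply hj, (incr j i h), hi.
      * apply hi, (incr i j h), hj.
Qed.

(** Up to [eps], [f] depends on a finite list of coordinates, each of which changes between [a i]
    and [b i] for at most one [i]. *)
Lemma jumps_are_c0 {W : Type} (a b : W -> K) (f : K -> R) eps :
  (forall c i j, phi (a i) c <> phi (b i) c -> phi (a j) c <> phi (b j) c -> i = j) ->
  rcont t f -> 0 < eps -> exists L, forall i, ~ In i L -> Rabs (f (b i) - f (a i)) < eps.
Proof.
  intros once cf e0.
  destruct (rcont_finitely_determined K t Kcompact I phi phi_cont phi_inj f eps cf e0) as [l Hl].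
  assert (h : exists L, forall i, ~ In i L -> forall c, In c l -> phi (b i) c = phi (a i) c).
  { clear Hl; induction l as [|c l [L HL]]; [exists nil; intros i _ c []|].
    destruct (classic (exists i, phi (a i) c <> phi (b i) c)) as [[i0 h0] | none].
    - exists (i0 :: L); intros i ni c' [<- | cl].
      + apply NNPP; intros ne; apply ni; left; apply (once c); auto.
      + apply HL; [intros h; apply ni; right; exact h | exact cl].
    - exists L; intros i ni c' [<- | cl]; [|apply HL; assumption].
      apply NNPP; intros ne; apply none; exists i; auto. }
  destruct h as [L HL]; exists L; intros i ni; apply Hl, HL, ni.
Qed.

End SigmaSubset.

(** * Banach spaces of bounded functions *)

Section FunctionSpace.

Variables (X : Type) (P : (X -> R) -> Prop).
Hypothesis P_bounded : forall h, P h -> bounded_fun h.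
Hypothesis P_zero : P (fun _ => 0).
Hypothesis P_lin : forall a b g h, P g -> P h -> P (fun x => a * g x + b * h x).
Hypothesis P_closed : forall h,
  (forall eps, 0 < eps -> exists g, P g /\ forall x, Rabs (g x - h x) <= eps) -> P h.

Lemma lin_closed_add g h : P g -> P h -> P (fun x => g x + h x).
Proof.
  intros Pg Ph; replace (fun x => g x + h x) with (fun x => 1 * g x + 1 * h x); [auto|].
  apply functional_extensionality; intros x; ring.
Qed.

Lemma lin_closed_scal a h : P h -> P (fun x => a * h x).
Proof.
  intros Ph; replace (fun x => a * h x) with (fun x => a * h x + 0 * h x); [auto|].
  apply functional_extensionality; intros x; ring.
Qed.

Lemma lin_closed_opp h : P h -> P (fun x => - h x).
Proof.
  intros Ph; replace (fun x => - h x) with (fun x => -1 * h x); [apply lin_closed_scal, Ph|].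
  apply functional_extensionality; intros x; ring.
Qed.

Lemma sig_fun_eq (g h : {h : X -> R | P h}) :
  (forall x, proj1_sig g x = proj1_sig h x) -> g = h.
Proof.
  destruct g as [g Pg], h as [h Ph]; cbn; intros e.
  apply subset_eq_compat, functional_extensionality, e.
Qed.

(** For completeness, a Cauchy sequence converges pointwise, hence uniformly by a passage to the
    limit in one index, and [P_closed] keeps the limit inside. *)
Definition function_space : Banach {h : X -> R | P h}.
Proof.
  refine {|
    bzero := exist P (fun _ => 0) P_zero;
    badd g h := exist P (fun x => proj1_sig g x + proj1_sig h x) (lin_closed_add _ _ (proj2_sig g) (proj2_sig h));
    bopp h := exist P (fun x => - proj1_sig h x) (lin_closed_opp _ (proj2_sig h));
    bscal a h := exist P (fun x => a * proj1_sig h x) (lin_closed_scal a _ (proj2_sig h));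
    bnorm h := sup_norm (proj1_sig h) |}.
  1-8: intros; apply sig_fun_eq; intros; cbn; first [apply Rplus_0_r | apply Rmult_1_l | ring].
  - intros [h Ph]; apply sup_norm_nonneg, P_bounded, Ph.
  - intros [h Ph] e; apply sig_fun_eq; intros x; cbn in *.
    assert (u := sup_norm_ub h x (P_bounded h Ph)); assert (p := Rabs_pos (h x)).
    destruct (Req_dec (h x) 0) as [z | nz]; [exact z|]; apply Rabs_pos_lt in nz; lra.
  - intros a [h Ph]; cbn; assert (bh := P_bounded h Ph).
    assert (bah := P_bounded _ (lin_closed_scal a h Ph)); assert (s0 := sup_norm_nonneg h bh).
    assert (a0 := Rabs_pos a); apply Rle_antisym.
    + apply sup_norm_le; [apply Rmult_le_pos; assumption|]; intros x; rewrite Rabs_mult.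
      apply Rmult_le_compat_l; [exact a0 | apply sup_norm_ub, bh].
    + destruct (Req_dec a 0) as [-> | na].
      * rewrite Rabs_R0, Rmult_0_l; apply sup_norm_nonneg, bah.
      * assert (ap := Rabs_pos_lt a na).
        apply Rmult_le_reg_l with (/ Rabs a); [apply Rinv_0_lt_compat, ap|].
        rewrite <- Rmult_assoc, Rinv_l, Rmult_1_l by lra.
        apply sup_norm_le.
        { apply Rmult_le_pos; [apply Rlt_le, Rinv_0_lt_compat, ap | apply sup_norm_nonneg, bah]. }
        intros x; assert (u := sup_norm_ub _ x bah); cbn in u; rewrite Rabs_mult in u.
        apply Rmult_le_reg_l with (Rabs a); [exact ap|].
        rewrite <- Rmult_assoc, Rinv_r, Rmult_1_l by lra; exact u.
  - intros [g Pg] [h Ph]; cbn.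
    assert (bg := P_bounded g Pg); assert (bh := P_bounded h Ph).
    assert (g0 := sup_norm_nonneg g bg); assert (h0 := sup_norm_nonneg h bh).
    apply sup_norm_le; [lra|]; intros x; apply Rle_trans with (1 := Rabs_triang _ _).
    apply Rplus_le_compat; apply sup_norm_ub; assumption.
  - cbn; intros u cauchy.
    assert (unif : forall eps, 0 < eps -> exists N, forall m n x, (N <= m)%nat -> (N <= n)%nat ->
               Rabs (proj1_sig (u m) x - proj1_sig (u n) x) < eps).
    { intros eps e0; destruct (cauchy eps e0) as [N HN]; exists N; intros m n x hm hn.
      apply Rle_lt_trans with (2 := HN m n hm hn).
      apply (sup_norm_ub (fun x => proj1_sig (u m) x + - proj1_sig (u n) x)).
      apply P_bounded, lin_closed_add; [|apply lin_closed_opp]; apply proj2_sig. }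
    destruct (choice_ex (fun x l => Un_cv (fun n => proj1_sig (u n) x) l)) as [l Hl].
    { intros x; destruct (R_complete (fun n => proj1_sig (u n) x)) as [l Hl]; [|exists l; exact Hl].
      intros eps e0; destruct (unif eps e0) as [N HN]; exists N; intros n m hn hm; apply HN; lia. }
    assert (cv : forall eps, 0 < eps -> exists N, forall n, (N <= n)%nat -> forall x,
              Rabs (proj1_sig (u n) x - l x) <= eps).
    { intros eps e0; destruct (unif (eps / 2)) as [N HN]; [lra|]; exists N; intros n hn x.
      destruct (Hl x (eps / 2)) as [M HM]; [lra|].
      specialize (HM (N + M)%nat ltac:(lia)); specialize (HN n (N + M)%nat x hn ltac:(lia)).
      unfold Rdist in HM.
      assert (tri := Rabs_triang (proj1_sig (u n) x - proj1_sig (u (N + M)%nat) x)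
                                 (proj1_sig (u (N + M)%nat) x - l x)).
      replace (proj1_sig (u n) x - proj1_sig (u (N + M)%nat) x + (proj1_sig (u (N + M)%nat) x - l x))
        with (proj1_sig (u n) x - l x) in tri by lra; lra. }
    assert (Pl : P l).
    { apply P_closed; intros eps e0; destruct (cv eps e0) as [N HN].
      exists (proj1_sig (u N)); split; [apply proj2_sig | apply HN; lia]. }
    exists (exist P l Pl); intros eps e0; destruct (cv (eps / 2)) as [N HN]; [lra|].
    exists N; intros n hn; apply Rle_lt_trans with (eps / 2); [|lra].
    apply sup_norm_le; [lra | apply HN, hn].
Defined.

End FunctionSpace.

(** * The twisted sum *)

Fixpoint sum_below (c : nat -> R) (m : nat) : R :=
  match m with O => 0 | S m => sum_below c m + c m end.

Lemma sum_below_disjoint (c : nat -> R) m :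
  (forall n, (n < m)%nat -> 0 <= c n <= 1) ->
  (forall n k, (n < m)%nat -> (k < m)%nat -> n <> k -> c n = 0 \/ c k = 0) ->
  0 <= sum_below c m <= 1.
Proof.
  intros range disj.
  (* Strengthened for the induction: the sum so far is 0 or has a nonzero term, and in the second
     case the next term vanishes. *)
  enough (h : 0 <= sum_below c m <= 1 /\ (sum_below c m = 0 \/ exists n, (n < m)%nat /\ c n <> 0)) by tauto.
  induction m as [|m IH]; cbn; [split; [lra | auto]|].
  destruct IH as [h1 h2]; [intros n hn; apply range; lia | intros n k hn hk; apply disj; lia|].
  assert (r := range m ltac:(lia)).
  destruct (Req_dec (c m) 0) as [z | nz].
  - rewrite z, Rplus_0_r; split; [exact h1|].
    destruct h2 as [h2 | [n [hn hc]]]; [auto | right; exists n; split; [lia | exact hc]].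
  - destruct h2 as [h2 | [n [hn hc]]].
    + rewrite h2, Rplus_0_l; split; [exact r | right; exists m; split; [lia | exact nz]].
    + destruct (disj n m) as [h | h]; [lia | lia | lia | contradiction | contradiction].
Qed.

Lemma eventually_below (Q : nat -> nat -> Prop) m :
  (forall k, (k < m)%nat -> exists N, forall p, (N <= p)%nat -> Q k p) ->
  exists N, forall k, (k < m)%nat -> forall p, (N <= p)%nat -> Q k p.
Proof.
  induction m as [|m IH]; intros H; [exists 0%nat; lia|].
  destruct IH as [N HN]; [intros k hk; apply H; lia|]; destruct (H m) as [N' HN']; [lia|].
  exists (N + N')%nat; intros k hk p hp.
  destruct (Nat.eq_dec k m) as [-> | ne]; [apply HN' | apply HN]; lia.
Qed.

Lemma c0_eventually_zero (y : nat -> R) N : (forall p, (N <= p)%nat -> y p = 0) -> c0 y.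
Proof.
  intros h eps e0; exists N; intros p hp; unfold Rdist; rewrite h, Rminus_0_r, Rabs_R0 by lia; exact e0.
Qed.

Lemma c0_zero : c0 (fun _ => 0).
Proof. apply (c0_eventually_zero _ 0); reflexivity. Qed.

Lemma Rabs_le_bounds x e : Rabs x <= e -> - e <= x <= e.
Proof. unfold Rabs; destruct Rcase_abs; lra. Qed.

Lemma Rabs_lin_le a b u v e :
  Rabs u <= e / (Rabs a + Rabs b + 1) -> Rabs v <= e / (Rabs a + Rabs b + 1) -> 0 < e ->
  Rabs (a * u + b * v) <= e.
Proof.
  intros hu hv e0; assert (a0 := Rabs_pos a); assert (b0 := Rabs_pos b).
  set (d := e / (Rabs a + Rabs b + 1)) in *.
  assert (ed : (Rabs a + Rabs b + 1) * d = e) by (unfold d; field; lra).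
  assert (d0 : 0 < d) by (apply Rdiv_lt_0_compat; lra).
  apply Rle_trans with (1 := Rabs_triang _ _); rewrite !Rabs_mult.
  assert (h1 := Rmult_le_compat_l _ _ _ a0 hu); assert (h2 := Rmult_le_compat_l _ _ _ b0 hv); lra.
Qed.

Lemma c0_lin a b y z : c0 y -> c0 z -> c0 (fun n => a * y n + b * z n).
Proof.
  intros cy cz eps e0.
  assert (d0 : 0 < eps / 2 / (Rabs a + Rabs b + 1)).
  { assert (a0 := Rabs_pos a); assert (b0 := Rabs_pos b); apply Rdiv_lt_0_compat; lra. }
  destruct (cy _ d0) as [N HN]; destruct (cz _ d0) as [M HM]; exists (N + M)%nat; intros n hn.
  specialize (HN n ltac:(lia)); specialize (HM n ltac:(lia)); unfold Rdist in *.
  rewrite Rminus_0_r in *; apply Rle_lt_trans with (eps / 2); [|lra].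
  apply Rabs_lin_le; lra.
Qed.

Lemma c0_bounded y : c0 y -> bounded_fun y.
Proof.
  intros cy; destruct (CV_Cauchy y (exist _ 0 cy) 1 Rlt_0_1) as [N HN].
  assert (h : exists M, forall n, (n < N)%nat -> Rabs (y n) <= M).
  { clear; induction N as [|N [M HM]]; [exists 0; lia|].
    exists (Rmax M (Rabs (y N))); intros n hn; destruct (Nat.eq_dec n N) as [-> | ne]; [apply Rmax_r|].
    apply Rle_trans with M; [apply HM; lia | apply Rmax_l]. }
  destruct h as [M HM]; exists (Rmax M (Rabs (y N) + 1)); intros n.
  destruct (Nat.lt_ge_cases n N) as [h | h].
  - apply Rle_trans with M; [apply HM, h | apply Rmax_l].
  - apply Rle_trans with (2 := Rmax_r _ _); specialize (HN n N h (Nat.le_refl N)); unfold Rdist in HN.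
    assert (tri := Rabs_triang (y n - y N) (y N)).
    replace (y n - y N + y N) with (y n) in tri by lra; lra.
Qed.

(** * The pullback space and its exact sequence *)

Section TwistedSum.

Variables (K : Type) (t : Topology K) (W : Type).
Variables (A : W -> nat -> Prop) (a b : W -> K).

(* [h] encodes a pair (f, u) in C(K) x l_infty such that, modulo c_0, u is the sum over i of
   (f (b i) - f (a i)) times the indicator of [A i]. *)
Definition twisted (h : K + nat -> R) : Prop :=
  bounded_fun h /\ rcont t (fun k => h (inl k)) /\
  (forall i eps, 0 < eps -> exists N, forall p, (N <= p)%nat -> A i p ->
     Rabs (h (inr p) - (h (inl (b i)) - h (inl (a i)))) <= eps) /\
  (forall eps, 0 < eps -> exists (L : list W) N, forall p, (N <= p)%nat ->
     (forall i, In i L -> ~ A i p) -> Rabs (h (inr p)) <= eps).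

Definition embed_c0 (y : nat -> R) (v : K + nat) : R :=
  match v with inl _ => 0 | inr p => y p end.

Lemma twisted_embed_c0 y : c0 y -> twisted (embed_c0 y).
Proof.
  intros cy; split; [|split; [|split]].
  - destruct (c0_bounded y cy) as [M HM]; exists (Rmax 0 M); intros [k | p]; cbn.
    + rewrite Rabs_R0; apply Rmax_l.
    + apply Rle_trans with (1 := HM p), Rmax_r.
  - intros x eps e0; exists (fun _ => True); split; [apply open_full | split; [exact I|]].
    intros z _; cbn; rewrite Rminus_diag, Rabs_R0; exact e0.
  - intros i eps e0; destruct (cy eps e0) as [N HN]; exists N; intros p hp _; cbn.
    specialize (HN p hp); unfold Rdist in HN; rewrite Rminus_diag; lra.
  - intros eps e0; destruct (cy eps e0) as [N HN]; exists nil, N; intros p hp _; cbn.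
    specialize (HN p hp); unfold Rdist in HN; rewrite Rminus_0_r in HN; lra.
Qed.

Lemma twisted_zero : twisted (fun _ => 0).
Proof.
  replace (fun _ : K + nat => 0) with (embed_c0 (fun _ => 0)).
  - apply twisted_embed_c0, c0_zero.
  - apply functional_extensionality; intros [k | p]; reflexivity.
Qed.

Lemma twisted_lin c d g h : twisted g -> twisted h -> twisted (fun v => c * g v + d * h v).
Proof.
  intros [[M HM] [cg [g1 g2]]] [[N HN] [ch [h1 h2]]].
  assert (pos : forall eps, 0 < eps -> 0 < eps / (Rabs c + Rabs d + 1)).
  { intros eps e0; assert (c0 := Rabs_pos c); assert (d0 := Rabs_pos d); apply Rdiv_lt_0_compat; lra. }
  split; [|split; [|split]].
  - exists (Rabs c * M + Rabs d * N); intros v.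
    apply Rle_trans with (1 := Rabs_triang _ _); rewrite !Rabs_mult.
    apply Rplus_le_compat; apply Rmult_le_compat_l; auto using Rabs_pos.
  - apply (rcont_of_two K t _ _ _ (Rabs c + Rabs d) cg ch); intros x y.
    replace (c * g (inl y) + d * h (inl y) - (c * g (inl x) + d * h (inl x)))
      with (c * (g (inl y) - g (inl x)) + d * (h (inl y) - h (inl x))) by lra.
    apply Rle_trans with (1 := Rabs_triang _ _); rewrite !Rabs_mult.
    assert (q1 := Rmult_le_pos _ _ (Rabs_pos c) (Rabs_pos (h (inl y) - h (inl x)))).
    assert (q2 := Rmult_le_pos _ _ (Rabs_pos d) (Rabs_pos (g (inl y) - g (inl x)))).
    lra.
  - intros i eps e0; destruct (g1 i _ (pos eps e0)) as [P HP]; destruct (h1 i _ (pos eps e0)) as [Q HQ].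
    exists (P + Q)%nat; intros p hp Ap.
    replace (_ - (_ - _)) with (c * (g (inr p) - (g (inl (b i)) - g (inl (a i)))) +
                      d * (h (inr p) - (h (inl (b i)) - h (inl (a i))))) by lra.
    apply Rabs_lin_le; [apply HP | apply HQ | exact e0]; solve [lia | exact Ap].
  - intros eps e0; destruct (g2 _ (pos eps e0)) as [L [P HP]]; destruct (h2 _ (pos eps e0)) as [L' [Q HQ]].
    exists (L ++ L'), (P + Q)%nat; intros p hp off.
    apply Rabs_lin_le; [apply HP | apply HQ | exact e0]; try lia; intros i il; apply off, in_or_app; auto.
Qed.

Lemma twisted_closed h :
  (forall eps, 0 < eps -> exists g, twisted g /\ forall v, Rabs (g v - h v) <= eps) -> twisted h.
Proof.
  intros H; split; [|split; [|split]].
  - destruct (H 1 Rlt_0_1) as [g [[[M HM] _] gh]]; exists (M + 1); intros v.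
    specialize (HM v); specialize (gh v); rewrite Rabs_minus_sym in gh.
    assert (tri := Rabs_triang (h v - g v) (g v)).
    replace (h v - g v + g v) with (h v) in tri by lra; lra.
  - intros x eps e0; destruct (H (eps / 4)) as [g [[_ [cg _]] gh]]; [lra|].
    destruct (cg x (eps / 4)) as [U [oU [Ux HU]]]; [lra|].
    exists U; split; [exact oU | split; [exact Ux|]]; intros y Uy; specialize (HU y Uy).
    assert (g1 := gh (inl x)); assert (g2 := gh (inl y)).
    apply Rabs_def2 in HU; apply Rabs_def1; apply Rabs_le_bounds in g1, g2; lra.
  - intros i eps e0; destruct (H (eps / 4)) as [g [[_ [_ [g1 _]]] gh]]; [lra|].
    destruct (g1 i (eps / 4)) as [N HN]; [lra|]; exists N; intros p hp Ap; specialize (HN p hp Ap).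
    assert (q1 := gh (inr p)); assert (q2 := gh (inl (b i))); assert (q3 := gh (inl (a i))).
    apply Rabs_le_bounds in HN, q1, q2, q3; apply Rabs_le; lra.
  - intros eps e0; destruct (H (eps / 4)) as [g [[_ [_ [_ g1]]] gh]]; [lra|].
    destruct (g1 (eps / 4)) as [L [N HN]]; [lra|]; exists L, N; intros p hp off; specialize (HN p hp off).
    assert (q1 := gh (inr p)); apply Rabs_le_bounds in HN, q1; apply Rabs_le; lra.
Qed.

Lemma twisted_bounded h : twisted h -> bounded_fun h.
Proof. intros [hb _]; exact hb. Qed.

Definition twisted_space : Banach {h | twisted h} :=
  function_space _ twisted twisted_bounded twisted_zero twisted_lin twisted_closed.

(** The value zero off [c0] is a default that makes the map total. *)
Definition twisted_j (y : nat -> R) : {h | twisted h} :=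
  match excluded_middle_informative (c0 y) with
  | left cy => exist _ (embed_c0 y) (twisted_embed_c0 y cy)
  | right _ => bzero twisted_space
  end.

Definition twisted_q (z : {h | twisted h}) (k : K) : R := proj1_sig z (inl k).

Lemma twisted_j_val y v : c0 y -> proj1_sig (twisted_j y) v = embed_c0 y v.
Proof. intros cy; unfold twisted_j; destruct excluded_middle_informative; [reflexivity | contradiction]. Qed.

Hypothesis Kcompact : tcompact t.
Hypothesis almost_disjoint : forall i j, i <> j -> finite_inter (A i) (A j).
Hypothesis jumps : forall f eps, rcont t f -> 0 < eps ->
  exists L, forall i, ~ In i L -> Rabs (f (b i) - f (a i)) < eps.

Lemma eventually_outside i L : exists N, forall p, (N <= p)%nat -> A i p ->
  forall j, In j L -> A j p -> j = i.
Proof.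
  induction L as [|j L [N HN]]; [exists 0%nat; intros p _ _ j []|].
  destruct (classic (j = i)) as [e | ne].
  - exists N; intros p hp Ap k [<- | kL]; [auto | apply HN; assumption].
  - destruct (almost_disjoint j i ne) as [M HM]; exists (N + S M)%nat; intros p hp Ap k [<- | kL] Ak.
    + specialize (HM p Ak Ap); lia.
    + apply (HN p); [lia | assumption..].
Qed.

(** Infinitely many [A i] may contain [p], so the formal sum is replaced by the [d i] of largest
    modulus with [A i p]. It exists because only finitely many jumps are at least as large as a
    given nonzero one. *)
Lemma twisted_lift f : rcont t f -> exists h, twisted h /\ forall k, h (inl k) = f k.
Proof.
  intros cf; set (d := fun i => f (b i) - f (a i)).
  assert (value : forall p, exists v,
     (v = 0 \/ exists i, A i p /\ v = d i) /\ forall i, A i p -> Rabs (d i) <= Rabs v).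
  { intros p; destruct (classic (exists i, A i p /\ d i <> 0)) as [[i0 [Ai0 d0]] | none].
    - apply Rabs_pos_lt in d0; destruct (jumps f _ cf d0) as [L HL].
      assert (h : exists i, A i p /\ Rabs (d i0) <= Rabs (d i) /\
                forall j, In j L -> A j p -> Rabs (d j) <= Rabs (d i)).
      { clear HL; induction L as [|k L [i [Ai [h1 h2]]]].
        - exists i0; split; [exact Ai0 | split; [lra | intros j []]].
        - destruct (classic (A k p /\ Rabs (d i) < Rabs (d k))) as [[Ak lt] | h].
          + exists k; split; [exact Ak | split; [lra|]]; intros j [<- | jL] Aj; [lra|].
            specialize (h2 j jL Aj); lra.
          + exists i; split; [exact Ai | split; [exact h1|]]; intros j [<- | jL] Aj; [|auto].
            apply Rnot_lt_le; intros lt; apply h; auto. }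
      destruct h as [i [Ai [h1 h2]]]; exists (d i); split; [right; exists i; auto|].
      intros j Aj; destruct (classic (In j L)) as [jL | nj]; [auto|].
      specialize (HL j nj); fold (d j) in HL; lra.
    - exists 0; split; [auto|]; intros i Ai.
      assert (e : d i = 0) by (apply NNPP; intros h; apply none; exists i; auto).
      rewrite e; lra. }
  destruct (choice_ex _ value) as [u Hu].
  exists (fun v => match v with inl k => f k | inr p => u p end); split; [|reflexivity].
  split; [|split; [exact cf | split]].
  - destruct (rcont_bounded K t Kcompact f cf) as [M HM]; exists (Rmax 0 (M + M)).
    intros [k | p]; [|destruct (Hu p) as [[-> | [i [_ ->]]] _]].
    + apply Rle_trans with (2 := Rmax_r _ _).
      assert (h := HM k); assert (h' := Rabs_pos (f k)); lra.
    + rewrite Rabs_R0; apply Rmax_l.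
    + apply Rle_trans with (2 := Rmax_r _ _); unfold d, Rminus.
      apply Rle_trans with (1 := Rabs_triang _ _); rewrite Rabs_Ropp.
      apply Rplus_le_compat; apply HM.
  (* If [d i = 0], the value at a late [p] in [A i] is 0 or a jump below [eps]. If not, only the
     finitely many jumps at least as large as [d i] compete, and by almost disjointness only [i]
     itself remains at late [p]. *)
  - intros i eps e0; destruct (Req_dec (d i) 0) as [di | di].
    + destruct (jumps f eps cf e0) as [L HL]; destruct (eventually_outside i L) as [N HN].
      exists N; intros p hp Ap; fold (d i); destruct (Hu p) as [[-> | [j [Aj ->]]] _].
      * rewrite di, Rminus_diag, Rabs_R0; lra.
      * destruct (classic (In j L)) as [jL | nj].
        -- rewrite (HN p hp Ap j jL Aj), Rminus_diag, Rabs_R0; lra.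
        -- rewrite di, Rminus_0_r; apply Rlt_le, HL, nj.
    + destruct (jumps f (Rabs (d i)) cf (Rabs_pos_lt _ di)) as [L HL].
      destruct (eventually_outside i L) as [N HN].
      exists N; intros p hp Ap; fold (d i); destruct (Hu p) as [[e | [j [Aj e]]] dom].
      * specialize (dom i Ap); rewrite e, Rabs_R0 in dom; apply Rabs_pos_lt in di; lra.
      * destruct (classic (In j L)) as [jL | nj].
        -- rewrite e, (HN p hp Ap j jL Aj), Rminus_diag, Rabs_R0; lra.
        -- specialize (dom i Ap); rewrite e in dom; specialize (HL j nj); fold (d j) in HL; lra.
  - intros eps e0; destruct (jumps f eps cf e0) as [L HL]; exists L, 0%nat; intros p _ off.
    destruct (Hu p) as [[-> | [j [Aj ->]]] _]; [rewrite Rabs_R0; lra|].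
    apply Rlt_le, HL; intros jL; exact (off j jL Aj).
Qed.

(** The jumps of the zero function vanish, so [h] tends to 0 along every [A i]; off finitely many
    [A i] it is eventually small anyway. *)
Lemma twisted_kernel h : twisted h -> (forall k, h (inl k) = 0) -> c0 (fun p => h (inr p)).
Proof.
  intros [_ [_ [h1 h2]]] h0 eps e0; destruct (h2 (eps / 2)) as [L [N HN]]; [lra|].
  assert (along : exists M, forall p, (M <= p)%nat -> forall i, In i L -> A i p -> Rabs (h (inr p)) <= eps / 2).
  { clear HN; induction L as [|i L [M HM]]; [exists 0%nat; intros p _ i []|].
    destruct (h1 i (eps / 2)) as [M' HM']; [lra|]; exists (M + M')%nat; intros p hp j [<- | jL] Aj.
    - specialize (HM' p ltac:(lia) Aj); rewrite !h0, Rminus_diag, Rminus_0_r in HM'; exact HM'.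
    - apply (HM p ltac:(lia) j jL Aj). }
  destruct along as [M HM]; exists (N + M)%nat; intros p hp; unfold Rdist; rewrite Rminus_0_r.
  apply Rle_lt_trans with (eps / 2); [|lra].
  destruct (classic (exists i, In i L /\ A i p)) as [[i [iL Ai]] | none].
  - apply (HM p ltac:(lia) i iL Ai).
  - apply HN; [lia|]; intros i iL Ai; apply none; exists i; auto.
Qed.

Lemma twisted_space_twisted_sum : twisted_sum_c0_CK t twisted_space twisted_j twisted_q.
Proof.
  split; [|split; [|split; [|split; [|split; [|split; [|split]]]]]].
  - intros c d y z cy cz; apply sig_fun_eq; intros v; cbn.
    rewrite !twisted_j_val by (try apply c0_lin; assumption); destruct v as [k | p]; cbn; ring.
  - exists 1; intros y c cy hc; cbn; rewrite Rmult_1_l.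
    assert (c_nonneg : 0 <= c) by (apply Rle_trans with (2 := hc 0%nat), Rabs_pos).
    apply sup_norm_le; [exact c_nonneg|]; intros v; rewrite twisted_j_val by exact cy.
    destruct v as [k | p]; cbn; [rewrite Rabs_R0; exact c_nonneg | apply hc].
  - intros [h [hb [ch hh]]]; exact ch.
  - reflexivity.
  - exists 1; intros [h hh] k; rewrite Rmult_1_l.
    apply (sup_norm_ub h), twisted_bounded, hh.
  - intros y z cy cz e; apply functional_extensionality; intros p.
    assert (h := f_equal (fun w => proj1_sig w (inr p)) e); cbn in h.
    rewrite !twisted_j_val in h by assumption; exact h.
  - intros z; split.
    + destruct z as [h hh]; intros e.
      assert (h0 : forall k, h (inl k) = 0) by (intros k; exact (f_equal (fun g => g k) e)).
      assert (cy := twisted_kernel h hh h0); exists (fun p => h (inr p)); split; [exact cy|].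
      apply sig_fun_eq; intros v; rewrite twisted_j_val by exact cy.
      destruct v as [k | p]; cbn; [symmetry; apply h0 | reflexivity].
    + intros [y [cy <-]]; apply functional_extensionality; intros k; unfold twisted_q.
      rewrite twisted_j_val by exact cy; reflexivity.
  - intros f cf; destruct (twisted_lift f cf) as [h [hh hf]]; exists (exist _ h hh).
    apply functional_extensionality, hf.
Qed.

(** * The copy of c_0 is not complemented *)

Variables (color : W -> nat) (f : W -> K -> R).
Hypothesis f_cont : forall i, rcont t (f i).
Hypothesis f_range : forall i k, 0 <= f i k <= 1.
Hypothesis f_jump : forall i, f i (b i) - f i (a i) = 1.
Hypothesis f_no_jump : forall i j, j <> i -> f i (b j) = f i (a j).
Hypothesis f_disjoint : forall i j k, color i <> color j -> f i k = 0 \/ f j k = 0.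
Hypothesis cones : forall n s (B : nat -> Prop), exists i, color i = n /\
  ((exists N, forall p, (N <= p)%nat -> A i p -> B p) ->
   exists u, anc s u /\ forall p, anc u p -> B p).

(* The canonical lift (f_i, 1_{A_i}) of [f i]. *)
Definition peak (i : W) (v : K + nat) : R :=
  match v with
  | inl k => f i k
  | inr p => if excluded_middle_informative (A i p) then 1 else 0
  end.

Lemma peak_range i v : 0 <= peak i v <= 1.
Proof. destruct v; cbn; [apply f_range | destruct excluded_middle_informative; lra]. Qed.

Lemma twisted_peak i : twisted (peak i).
Proof.
  split; [|split; [apply f_cont | split]].
  - exists 1; intros v; assert (h := peak_range i v); apply Rabs_le; lra.
  - intros j eps e0; destruct (classic (j = i)) as [-> | ne].
    + exists 0%nat; intros p _ Ap; cbn; rewrite f_jump.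
      destruct excluded_middle_informative; [|contradiction]; rewrite Rminus_diag, Rabs_R0; lra.
    + destruct (almost_disjoint j i ne) as [N HN]; exists (S N); intros p hp Aj; cbn.
      destruct excluded_middle_informative as [Ai |]; [specialize (HN p Aj Ai); lia|].
      rewrite f_no_jump, !Rminus_diag, Rabs_R0 by exact ne; lra.
  - intros eps e0; exists (i :: nil), 0%nat; intros p _ off; cbn.
    destruct excluded_middle_informative as [Ai |]; [|rewrite Rabs_R0; lra].
    exfalso; apply (off i); [left; reflexivity | exact Ai].
Qed.

Lemma nested_cones (B : nat -> nat -> Prop) :
  (forall n s, exists u, anc s u /\ forall p, anc u p -> B n p) ->
  forall m, exists p, forall n, (n < m)%nat -> B n p.
Proof.
  intros H m.
  enough (h : exists s, forall p, anc s p -> forall n, (n < m)%nat -> B n p).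
  { destruct h as [s hs]; exists s; apply hs; constructor. }
  induction m as [|m [s IH]]; [exists 0%nat; intros p _ n hn; lia|].
  destruct (H m s) as [u [su hu]]; exists u; intros p up n hn.
  destruct (Nat.eq_dec n m) as [-> | ne]; [apply hu, up | apply IH; [|lia]].
  apply (anc_trans _ u); assumption.
Qed.

(* Correcting sum_n (f_{i_n}, 1_{A_{i_n}}) by [y] in c_0 brings its norm down to 1: distinct
   colours make the f's disjointly supported, and the A's are eventually disjoint. *)
Lemma twisted_lin_comb_disjoint (i : nat -> W) m :
  (forall n, (n < m)%nat -> color (i n) = n) ->
  exists y (w : {h | twisted h}), c0 y /\ (forall v, Rabs (proj1_sig w v) <= 1) /\
    forall v, proj1_sig w v = sum_below (fun n => peak (i n) v) m + embed_c0 y v.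
Proof.
  intros Hi.
  assert (ne : forall n k, (n < m)%nat -> (k < m)%nat -> n <> k -> color (i n) <> color (i k)).
  { intros n k hn hk nk; rewrite !Hi; assumption. }
  destruct (eventually_below (fun n p => forall k, (k < m)%nat -> n <> k -> A (i n) p -> ~ A (i k) p) m)
    as [N HN].
  { intros n hn.
    destruct (eventually_below (fun k p => n <> k -> A (i n) p -> ~ A (i k) p) m) as [N HN].
    - intros k hk; destruct (classic (n = k)) as [e | nk]; [exists 0%nat; contradiction|].
      destruct (almost_disjoint (i n) (i k)) as [N HN].
      { intros e; apply (ne n k hn hk nk); rewrite e; reflexivity. }
      exists (S N); intros p hp _ A1 A2; specialize (HN p A1 A2); lia.
    - exists N; intros p hp k hk; apply HN; assumption. }
  (* [y] cancels the sum at the finitely many [p] below [N], before the sets [A (i n)] have become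
     disjoint. *)
  set (y := fun p => if Nat.ltb p N then - sum_below (fun n => peak (i n) (inr p)) m else 0).
  assert (cy : c0 y).
  { apply (c0_eventually_zero y N); intros p hp; unfold y.
    destruct (Nat.ltb_spec p N); [lia | reflexivity]. }
  assert (tw : twisted (fun v => sum_below (fun n => peak (i n) v) m + embed_c0 y v)).
  { apply (lin_closed_add _ twisted twisted_lin (fun v => sum_below (fun n => peak (i n) v) m)); [|apply twisted_embed_c0, cy].
    clear y cy N HN ne Hi; induction m as [|m IH]; cbn; [apply twisted_zero|].
    apply (lin_closed_add _ twisted twisted_lin (fun v => sum_below (fun n => peak (i n) v) m)); [exact IH | apply twisted_peak]. }
  exists y, (exist _ _ tw); split; [exact cy | split; [|reflexivity]]; cbn.
  assert (unit : forall v, (forall n k, (n < m)%nat -> (k < m)%nat -> n <> k -> peak (i n) v = 0 \/ peak (i k) v = 0) ->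
     Rabs (sum_below (fun n => peak (i n) v) m) <= 1).
  { intros v hv; destruct (sum_below_disjoint (fun n => peak (i n) v) m) as [q1 q2].
    - intros n _; apply peak_range.
    - exact hv.
    - apply Rabs_le; lra. }
  intros [k | p]; cbn [embed_c0].
  - rewrite Rplus_0_r; apply unit; intros n k' hn hk nk; apply f_disjoint, ne; assumption.
  - unfold y; destruct (Nat.ltb_spec p N) as [lt | ge].
    + rewrite Rplus_opp_r, Rabs_R0; lra.
    + rewrite Rplus_0_r; apply unit; intros n k hn hk nk; cbn.
      destruct (excluded_middle_informative (A (i n) p)) as [A1 | A1]; [right | auto].
      destruct excluded_middle_informative as [A2 | A2]; [|reflexivity].
      destruct (HN n hn p ge k hk nk A1 A2).
Qed.

Lemma twisted_space_not_complemented : ~ image_complemented twisted_space twisted_j.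
Proof.
  intros [P [Plin [[M HM] [Pim Pid]]]].
  set (z := fun i => exist twisted (peak i) (twisted_peak i)).
  (* The coordinates of [w - P w]: they vanish on the image of c_0, so the correction by [y] costs
     nothing, and are at most [1 + Rabs M] on the unit ball. *)
  set (T := fun (w : {h | twisted h}) p => proj1_sig w (inr p) - proj1_sig (P w) (inr p)).
  assert (T_lin : forall c d w1 w2 w p,
     (forall v, proj1_sig w v = c * proj1_sig w1 v + d * proj1_sig w2 v) ->
     T w p = c * T w1 p + d * T w2 p).
  { intros c d w1 w2 w p hw.
    assert (e : w = badd twisted_space (bscal twisted_space c w1) (bscal twisted_space d w2)).
    { apply sig_fun_eq, hw. }
    assert (e' : proj1_sig (P w) (inr p) = c * proj1_sig (P w1) (inr p) + d * proj1_sig (P w2) (inr p)).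
    { rewrite e, Plin; reflexivity. }
    unfold T; rewrite hw, e'; ring. }
  assert (T_c0 : forall y p, c0 y -> T (twisted_j y) p = 0).
  { intros y p cy; unfold T; rewrite Pid by exact cy; apply Rminus_diag. }
  assert (T_bound : forall w p, (forall v, Rabs (proj1_sig w v) <= 1) -> T w p <= 1 + Rabs M).
  { intros w p hw; assert (h1 := hw (inr p)).
    assert (nw : bnorm twisted_space w <= 1) by (apply sup_norm_le; [lra | exact hw]).
    assert (nw0 : 0 <= bnorm twisted_space w) by apply bnorm_nonneg.
    assert (h2 : Rabs (proj1_sig (P w) (inr p)) <= Rabs M).
    { apply Rle_trans with (bnorm twisted_space (P w)).
      - apply (sup_norm_ub (proj1_sig (P w))), twisted_bounded, proj2_sig.
      - apply Rle_trans with (1 := HM w); rewrite <- (Rmult_1_r (Rabs M)).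
        assert (h := Rle_abs M); assert (h' := Rabs_pos M).
        apply Rle_trans with (Rabs M * bnorm twisted_space w);
          [apply Rmult_le_compat_r | apply Rmult_le_compat_l]; assumption. }
    apply Rabs_le_bounds in h1, h2; unfold T; lra. }
  (* Any index of colour [n] may witness [B n p], so [B n] almost contains every [A i] of that
     colour, in particular the one that [cones] provides. *)
  set (B := fun n p => exists i, color i = n /\ / 2 < T (z i) p).
  assert (HB : forall n s, exists u, anc s u /\ forall p, anc u p -> B n p).
  { intros n s; destruct (cones n s (B n)) as [i [ci Hi]]; apply Hi.
    destruct (Pim (z i)) as [y [cy ey]]; destruct (cy (/ 2)) as [N HN]; [lra|].
    exists N; intros p hp Ap; exists i; split; [exact ci|]; unfold T; rewrite ey.
    rewrite twisted_j_val by exact cy; cbn.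
    destruct excluded_middle_informative; [|contradiction].
    specialize (HN p hp); unfold Rdist in HN; apply Rabs_def2 in HN; lra. }
  (* Each of [m] peaks contributes more than 1/2, so this [m] pushes the sum beyond [1 + Rabs M]. *)
  destruct (INR_unbounded (2 * (1 + Rabs M))) as [m hm].
  destruct (nested_cones B HB m) as [p Hp].
  destruct (cones 0%nat 0%nat (fun _ => True)) as [i0 _].
  destruct (choice_ex (fun n i => (n < m)%nat -> color i = n /\ / 2 < T (z i) p)) as [i Hi].
  { intros n; destruct (Nat.lt_ge_cases n m) as [h | h]; [destruct (Hp n h) as [i Hi]; exists i; auto|].
    exists i0; intros h'; lia. }
  destruct (twisted_lin_comb_disjoint i m) as [y [w [cy [w1 hw]]]]; [intros n hn; apply (Hi n hn)|].
  assert (T_sum : T w p = sum_below (fun n => T (z (i n)) p) m).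
  { assert (zs : forall k, exists s : {h | twisted h},
       (forall v, proj1_sig s v = sum_below (fun n => peak (i n) v) k) /\
       T s p = sum_below (fun n => T (z (i n)) p) k).
    { induction k as [|k [s [s1 s2]]].
      - exists (bzero twisted_space); split; [reflexivity|].
        rewrite (T_lin 0 0 (z i0) (z i0)) by (intros v; cbn; ring); cbn; ring.
      - exists (badd twisted_space s (z (i k))); split; [intros v; cbn; rewrite s1; reflexivity|].
        rewrite (T_lin 1 1 s (z (i k))) by (intros v; rewrite !Rmult_1_l; reflexivity); cbn [sum_below]; rewrite s2; ring. }
    destruct (zs m) as [s [s1 s2]].
    rewrite (T_lin 1 1 s (twisted_j y)), T_c0, s2; [ring | exact cy|].
    intros v; rewrite hw, s1, twisted_j_val by exact cy; ring. }
  assert (low : forall k, (k <= m)%nat -> INR k / 2 <= sum_below (fun n => T (z (i n)) p) k).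
  { induction k as [|k IH]; intros hk; [cbn; lra|].
    rewrite S_INR; cbn [sum_below]; specialize (IH ltac:(lia)); destruct (Hi k ltac:(lia)); lra. }
  specialize (low m (Nat.le_refl m)); rewrite <- T_sum in low; specialize (T_bound w p w1); lra.
Qed.

End TwistedSum.

(** * Choice of the test functions and assembly *)

Lemma rcont_bump {K : Type} (t : Topology K) (g h : K -> R) (c : R) :
  rcont t g -> rcont t h -> (forall z, 0 <= g z <= 1) -> 0 < c ->
  rcont t (fun z => g z * Rmin 1 (Rabs (h z) / c)).
Proof.
  intros cg ch g01 c0; assert (ic := Rinv_0_lt_compat c c0).
  apply (rcont_of_two K t g h _ (1 + / c) cg ch); intros x y.
  set (u := fun z => Rmin 1 (Rabs (h z) / c)).
  assert (u01 : forall z, 0 <= u z <= 1).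
  { intros z; split; [|apply Rmin_l]; apply Rmin_glb; [lra|].
    apply Rmult_le_pos; [apply Rabs_pos | lra]. }
  assert (du : Rabs (u y - u x) <= / c * Rabs (h y - h x)).
  { apply Rle_trans with (1 := Rmin_1_lipschitz _ _); unfold Rdiv.
    rewrite <- Rmult_minus_distr_r, Rabs_mult, (Rabs_pos_eq (/ c)), Rmult_comm by lra.
    apply Rmult_le_compat_l; [lra | apply Rabs_triang_inv2]. }
  fold (u x) (u y); replace (g y * u y - g x * u x) with (g y * (u y - u x) + (g y - g x) * u x) by ring.
  apply Rle_trans with (1 := Rabs_triang _ _); rewrite !Rabs_mult.
  rewrite (Rabs_pos_eq (g y)), (Rabs_pos_eq (u x)) by (apply g01 || apply u01).
  assert (h1 := Rmult_le_compat_r _ _ _ (Rabs_pos (u y - u x)) (proj2 (g01 y))).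
  assert (h2 := Rmult_le_compat_l _ _ _ (Rabs_pos (g y - g x)) (proj2 (u01 x))).
  assert (h3 := Rabs_pos (h y - h x)).
  assert (h4 := Rmult_le_pos _ _ (Rlt_le _ _ ic) (Rabs_pos (g y - g x))).
  lra.
Qed.

Theorem theorem3p4 :
  CH ->
  forall (K : Type) (t : Topology K),
    tcompact t -> thausdorff t ->
    forall A : K -> Prop,
      Sigma_subset t A -> tdense t A ->
      (exists (x : K) (s : nat -> K), ~ A x /\ nontrivial_seq s /\ tconverges t s x) ->
      exists (Z : Type) (B : Banach Z) (j : (nat -> R) -> Z) (q : Z -> K -> R),
        twisted_sum_c0_CK t B j q /\ ~ image_complemented B j.
Proof.
  intros ch K t Kcompact _ A [I [phi [phi_cont [phi_inj A_sigma]]]] A_dense [x [s [nAx [nontriv sx]]]].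
  destruct (CH_omega1_like ch) as [lt ol]; destruct R_surjects_codes as [code Hcode].
  set (color := fun i => fst (fst (code i))).
  destruct (diagonal_family lt (fun i => snd (fst (code i))) (fun i => snd (code i)) ol) as [D [D_ad D_diag]].
  destruct (disjoint_bumps K t I phi A phi_cont phi_inj A_sigma x s nAx nontriv sx)
    as [e [y [g [nAy [g_cont [g_range [g_y [g_disj g_dep]]]]]]]].
  destruct (coordinate_chain K t I phi A phi_cont A_sigma Kcompact A_dense lt e (fun i => y (color i)) ol)
    as [k [a [b [ab_e [ab_k once]]]]]; [intros i; apply nAy|].
  (* The second factor is 0 at [a i] and 1 at [b i]. For [j] other than [i] the coordinate [k i]
     does not change between [a j] and [b j], and the bump takes equal values at both, so [f i] does
     not jump there. *)
  set (f := fun i z => g (color i) z * Rmin 1 (Rabs (phi z (k i)) / Rabs (phi (y (color i)) (k i)))).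
  assert (g_a : forall n j, g n (a j) = g n (y (color j))) by (intros n j; apply g_dep, ab_e).
  assert (g_b : forall n j, g n (b j) = g n (y (color j))) by (intros n j; apply g_dep, ab_e).
  assert (c_pos : forall i, 0 < Rabs (phi (y (color i)) (k i))).
  { intros i; apply Rabs_pos_lt, ab_k. }
  exists {h | twisted K t R D a b h}, (twisted_space K t R D a b),
    (twisted_j K t R D a b), (twisted_q K t R D a b).
  assert (jumps : forall h eps, rcont t h -> 0 < eps ->
            exists L, forall i, ~ In i L -> Rabs (h (b i) - h (a i)) < eps).
  { intros h eps; apply (jumps_are_c0 K t I phi phi_cont phi_inj Kcompact a b h eps once). }
  split; [apply twisted_space_twisted_sum; assumption|].
  apply (twisted_space_not_complemented K t R D a b D_ad color f).
  - intros i; apply rcont_bump; auto.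
  - intros i z; unfold f; assert (h := g_range (color i) z).
    assert (h1 : 0 <= Rmin 1 (Rabs (phi z (k i)) / Rabs (phi (y (color i)) (k i)))).
    { apply Rmin_glb; [lra|]; apply Rmult_le_pos; [apply Rabs_pos|].
      apply Rlt_le, Rinv_0_lt_compat, c_pos. }
    split; [apply Rmult_le_pos; tauto|].
    apply Rle_trans with (1 * 1); [apply Rmult_le_compat; try tauto; apply Rmin_l | lra].
  - intros i; unfold f; rewrite g_a, g_b, g_y; destruct (ab_k i) as [_ [-> ->]].
    specialize (c_pos i); unfold Rdiv; rewrite Rinv_r, Rabs_R0 by lra.
    rewrite Rmin_left, Rmin_right by lra; ring.
  - intros i j ne; unfold f; rewrite g_a, g_b; f_equal; f_equal; f_equal; f_equal.
    apply NNPP; intros h; apply ne, (once (k i)); [auto|].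
    destruct (ab_k i) as [h1 [-> ->]]; auto.
  - intros i j z ne; unfold f.
    destruct (g_disj (color i) (color j) z ne) as [-> | ->]; [left | right]; ring.
  (* Surjectivity of [code] yields an index whose task is exactly this colour, node and target
     set. *)
  - intros n u B; destruct (Hcode (n, u, B)) as [i Hi]; exists i; split.
    + unfold color; rewrite Hi; reflexivity.
    + specialize (D_diag i); rewrite Hi in D_diag; exact D_diag.
Qed.
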